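(* For every H-type group $N$, the solvable group $S=NA$, endowed with its canonical left-invariant Riemannian metric, is a harmonic Riemannian space.
   Context: H-type algebra: a two-step nilpotent real finite-dimensional Lie algebra $\mathfrak n$ with an inner product $\langle\cdot,\cdot\rangle$ such that, if $\mathfrak z$ is the center of $\mathfrak n$ and $\mathfrak v=\mathfrak z^\perp$, then the map $J_Z:\mathfrak v\to\mathfrak v$ defined by $\langle J_ZX,Y\rangle=\langle [X,Y],Z\rangle$ for $X,Y\in\mathfrak v$, $Z\in\mathfrak z$, satisfies $J_Z^2=-|Z|^2 I$ for every $Z\in\mathfrak z$. An H-type group is a connected and simply connected Lie group $N$ whose Lie algebra is H-type. The extension $S=NA$: let $\mathfrak s=\mathfrak v\oplus\mathfrak z\oplus\mathbb R T$ be the Lie algebra extending $\mathfrak n=\mathfrak v\oplus\mathfrak z$ by the rule $[T,X+Z]=\tfrac12 X+Z$ for $X\in\mathfrak v$, $Z\in\mathfrak z$. Let $S=NA$ be the corresponding connected and simply connected Lie group, where $A=\exp_S(\mathbb R T)$. Elements of $S$ are parametrized by triples $(X,Z,a)\in\mathfrak v\oplus\mathfrak z\oplus\mathbb R^+$ through $(X,Z,a)=\exp_S(X+Z)\exp_S(\log a\,T)$; the product is $$(X,Z,a)(X',Z',a')=\bigl(X+a^{1/2}X',\ Z+aZ'+\tfrac12 a^{1/2}[X,X'],\ aa'\bigr).$$ The Riemannian metric on $S$ is the left-invariant one induced by the inner product $\langle X+Z+tT\,|\,X'+Z'+t'T\rangle=\langle X,X'\rangle+\langle Z,Z'\rangle+tt'$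 on $\mathfrak s$. Harmonic: a Riemannian space $M$ with Laplace-Beltrami operator $\Delta$ and geodesic distance $d$ is called harmonic if, for every point $x_0\in M$ and every function $f$ on $M$ such that $f(x)$ depends only on $d(x,x_0)$, also $\Delta f(x)$ depends only on $d(x,x_0)$. Equivalently, for every $x_0\in M$ the volume density function $\omega_{x_0}(x)$ expressed in terms of the normal coordinates around $x_0$ is a function of $d(x,x_0)$. *)

(* Defs.v *)
From HB Require Import structures.
From mathcomp Require Import all_boot all_order all_algebra.
From mathcomp Require Import all_classical all_reals all_analysis.

Set Implicit Arguments.
Unset Strict Implicit.
Unset Printing Implicit Defensive.

Import Order.TTheory GRing.Theory Num.Theory.
Import numFieldNormedType.Exports.
Import passmx.

Local Open Scope classical_set_scope.
Local Open Scope ring_scope.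

(** A Riemannian metric on an open set [U] of R^m is given by its Gram matrices
    [G x] in the standard basis; the values of [G] and of functions outside [U]
    are irrelevant. *)

Section Riemannian.
Context {R : realType} {m : nat}.
Implicit Types (U : set 'rV[R]_m) (G : 'rV[R]_m -> 'M[R]_m).
Implicit Types (f : 'rV[R]_m -> R) (x y p q : 'rV[R]_m) (c : R -> 'rV[R]_m).

Definition partial (i : 'I_m) f x : R := 'D_(delta_mx 0 i) f x.

Fixpoint Ck (k : nat) U f : Prop :=
  (forall x, U x -> {for x, continuous f}) /\
  (if k is k'.+1 then
     forall i, (forall x, U x -> derivable f x (delta_mx 0 i)) /\
               Ck k' U (partial i f)
   else True).

Definition smooth U f : Prop := forall k, Ck k U f.

Definition riemannian_space U G : Prop :=
  [/\ open U,
      connected U,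
      (forall i j, smooth U (fun x => G x i j)),
      (forall x, U x -> (G x)^T = G x) &
      (forall x (u : 'rV[R]_m), U x -> u != 0 -> 0 < (u *m G x *m u^T) 0 0)].

(** [div grad] in coordinates, where [vol] is the Riemannian volume density
    and [invmx (G y)] the cometric. *)
Definition laplace_beltrami G f x : R :=
  let vol y := Num.sqrt (\det (G y)) in
  (vol x)^-1 *
  \sum_i partial i
    (fun y => vol y * \sum_j invmx (G y) i j * partial j f y) x.

Definition speed G c (t : R) : R :=
  Num.sqrt ((derive1 c t *m G (c t) *m (derive1 c t)^T) 0 0).

Definition arc_length G c : R :=
  \int[lebesgue_measure]_(t in `[0, 1]) speed G c t.

(** A C^1 curve on the closed interval [0, 1] is one that extends to a C^1
    curve on R; only the part over [0, 1] has to stay in [U]. *)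
Definition C1_arc U c : Prop :=
  [/\ (forall t, derivable c t 1),
      continuous (derive1 c) &
      (forall t, 0 <= t <= 1 -> U (c t))].

(** Piecewise C^1 curves are finite concatenations of C^1 arcs, each
    parametrized by [0, 1]: [path_length U G p q l] says that some such curve
    in [U] from [p] to [q] has length [l]. *)
Inductive path_length U G : 'rV[R]_m -> 'rV[R]_m -> R -> Prop :=
| path_length_nil p : U p -> path_length U G p p 0
| path_length_cons c q l : C1_arc U c -> path_length U G (c 1) q l ->
    path_length U G (c 0) q (arc_length G c + l).

Definition geodesic_dist U G p q : R := inf [set l | path_length U G p q l].

Definition radial U G p f : Prop :=
  forall x y, U x -> U y ->
    geodesic_dist U G x p = geodesic_dist U G y p -> f x = f y.

Definition harmonic_space U G : Prop :=
  riemannian_space U G /\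
  forall p f, U p -> Ck 2 U f -> radial U G p f ->
    radial U G p (laplace_beltrami G f).

End Riemannian.

Section HType.
Context {R : realType} {n : vectType R}.
Variables (br : {bilinear n -> n -> n}) (ip : {dot n for idfun}).

Definition lie_bracket : Prop :=
  (forall x, br x x = 0) /\
  (forall x y z, br x (br y z) + br y (br z x) + br z (br x y) = 0).

Definition two_step_nilpotent : Prop :=
  (forall x y z, br x (br y z) = 0) /\ (exists x y, br x y != 0).

(** See [lie_centerP] for the pointwise characterization. *)
Definition lie_center : {vspace n} :=
  lker (linfun (fun x => linfun (br x))).

Definition v_space : {vspace n} := orthov ip lie_center.

Definition is_Jmap (Z : n) (J : n -> n) : Prop :=
  forall X, X \in v_space ->
    J X \in v_space /\
    forall Y, Y \in v_space -> ip (J X) Y = ip (br X Y) Z.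

(** The conditions [is_Jmap Z J] determine [J] on [v_space]. *)
Definition h_type_algebra : Prop :=
  [/\ lie_bracket, two_step_nilpotent &
      forall Z, Z \in lie_center ->
        exists2 J, is_Jmap Z J &
          forall X, X \in v_space -> J (J X) = - ip Z Z *: X].

(** The element (X, Z, a) of the solvable extension S is encoded as the pair
    (X + Z, a), with 0 < a; the components X and Z are recovered by the
    orthogonal projections [vpart] and [zpart]. *)

Definition vpart (W : n) : n := daddv_pi v_space lie_center W.
Definition zpart (W : n) : n := daddv_pi lie_center v_space W.

Definition s_mul (p q : n * R) : n * R :=
  ((vpart p.1 + Num.sqrt p.2 *: vpart q.1) +
   (zpart p.1 + p.2 *: zpart q.1 +
    (2^-1 * Num.sqrt p.2) *: br (vpart p.1) (vpart q.1)),
   p.2 * q.2).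

Definition s_inv (p : n * R) : n * R :=
  (- (Num.sqrt p.2)^-1 *: vpart p.1 - p.2^-1 *: zpart p.1, p.2^-1).

(** On the Lie algebra of S, where (X + Z, t) stands for X + Z + tT. *)
Definition s_dot (p q : n * R) : R := ip p.1 q.1 + p.2 * q.2.

(** A global chart of S, onto the half-space [s_domain]. *)
Definition s_chart (p : n * R) : 'rV[R]_(1 + \dim {:n}) :=
  row_mx p.2%:M (rVof (vbasis {:n}) p.1).

Definition s_point (x : 'rV[R]_(1 + \dim {:n})) : n * R :=
  (vecof (vbasis {:n}) (rsubmx x), lsubmx x 0 0).

Definition s_domain : set 'rV[R]_(1 + \dim {:n}) := [set x | 0 < (s_point x).2].

Definition left_translation (p : n * R) (x : 'rV[R]_(1 + \dim {:n})) :
  'rV[R]_(1 + \dim {:n}) := s_chart (s_mul p (s_point x)).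

(** The differential at [x] of the left translation by the inverse of [x],
    from the tangent space at [x] to the one at the identity (0, 1). The latter
    is the Lie algebra of S via [s_point], because the derivative at the origin
    of X + Z + tT |-> exp(X + Z) exp(tT) = (X + Z, e^t) is the identity. *)
Definition maurer_cartan (x u : 'rV[R]_(1 + \dim {:n})) : n * R :=
  s_point ('d (left_translation (s_inv (s_point x))) x u).

Definition s_metric (x : 'rV[R]_(1 + \dim {:n})) : 'M[R]_(1 + \dim {:n}) :=
  \matrix_(i, j) s_dot (maurer_cartan x (delta_mx 0 i))
                       (maurer_cartan x (delta_mx 0 j)).

Lemma ad_is_linear : linear (fun x => linfun (br x)).
Proof.
move=> a x y; apply/lfunP => z.
by rewrite add_lfunE scale_lfunE !lfunE /= linearPl.
Qed.

Lemma lie_centerP Z : reflect (forall X, br Z X = 0) (Z \in lie_center).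
Proof.
have linE x : linfun (fun y => linfun (br y)) x = linfun (br x).
  pose ad := GRing.isLinear.Build R n 'Hom(n, n) *:%R _ ad_is_linear.
  pose adL : {linear n -> 'Hom(n, n)} := HB.pack (fun y => linfun (br y)) ad.
  exact: (lfunE adL x).
rewrite memv_ker linE; apply: (iffP eqP) => [Z0 X|Z0].
  by move/lfunP/(_ X): Z0; rewrite lfunE zero_lfunE.
by apply/lfunP => X; rewrite lfunE zero_lfunE /= Z0.
Qed.

End HType.

(* Main.v *)
From HB Require Import structures.
Require Import Defs.
From mathcomp Require Import all_boot all_order all_algebra ring lra.
From mathcomp Require Import all_classical all_reals all_analysis.

(** Fix p = (X1, Z1, b), and for x = (X, Z, a) put V = X - X1,
    zeta = Z - Z1 - [X1, X] / 2, beta = a + b + |V|^2 / 4 and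
    Q = (beta^2 + |zeta|^2) / (4 a b).
    The H-type identities |J_z v|^2 = |z|^2 |v|^2 and [v, J_z v] = |v|^2 z give
    |grad Q|^2 = Q^2 - Q and Delta Q = kappa Q - (1 + dim z) / 2, where
    kappa = 1 + dim v / 2 + dim z. Hence Delta (F o Q) is a function of Q.
    It remains to see that Q = cosh^2 (d / 2), d the distance to p. The formula
    for |grad Q| bounds the length of every curve from below by the variation of
    d, and the image of a radius of the unit ball under the Cayley transform is
    a curve for which equality holds. *)

Set Implicit Arguments.
Unset Strict Implicit.
Unset Printing Implicit Defensive.

Import Order.TTheory GRing.Theory Num.Theory.
Import numFieldNormedType.Exports.
Import passmx.

Local Open Scope classical_set_scope.
Local Open Scope ring_scope.

(** * Differential calculus *)

Section Calculus.
Context {R : realType}.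

(** Where Q comes from: |grad d| = 1 gives |grad cosh^2(d / 2)|^2 = cosh^2(d / 2) sinh^2(d / 2), so
    |grad Q|^2 = Q^2 - Q is the eikonal equation of d in disguise. Since one explicit curve attains
    the bound that this equation puts on lengths, d is known without geodesic equations, exponential
    map or curvature. The point p stays arbitrary. Moving it to the identity would require the
    invariance of distance and Laplacian under left translations; V, zeta and b carry the
    translation instead. Two difficulties sit at p. The distance is not differentiable there, so
    lengths are bounded through a smoothed distance. And a C^2 radial f is written F o Q with F
    differentiated only where Q > 1; but Q = 1 at p alone, so p is a sphere by itself and nothing
    has to be compared there. In Delta Q, both the coordinate divergence of the gradient and the
    contribution of the density a^-kappa contain beta, which is not a function of Q; these terms
    cancel. *)

Lemma is_derive_coord (V : normedModType R) m n (f : V -> 'M[R]_(m, n)) x v df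
    i j :
  is_derive x v f df -> is_derive x v (fun y => f y i j) (df i j).
Proof.
move=> [exf <-]; apply: DeriveDef; first by move/derivable_mxP: exf; apply.
by rewrite derive_mx// mxE.
Qed.

Lemma is_derive_mx (V : normedModType R) m n (f : V -> 'M[R]_(m, n)) x v
    (df : 'M[R]_(m, n)) :
  (forall i j, is_derive x v (fun y => f y i j) (df i j)) -> is_derive x v f df.
Proof.
move=> H; have exf : derivable f x v.
  by apply/derivable_mxP => i j; apply: ex_derive.
apply: DeriveDef => //; rewrite derive_mx//.
by apply/matrixP => i j; rewrite mxE; apply: derive_val.
Qed.

Lemma is_derive_scalev (V W : normedModType R) (k : V -> R) (w : W) x v dk :
  is_derive x v k dk -> is_derive x v (fun y => k y *: w) (dk *: w).
Proof.
move=> [exk <-].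
have H : (fun h => h^-1 *: (((fun y => k y *: w) \o shift x) (h *: v) - k x *: w))
    @ 0^' --> 'D_v k x *: w.
  rewrite [X in X @ _](_ : _ = (fun c : R => c *: w) \o
    (fun h => h^-1 *: ((k \o shift x) (h *: v) - k x))); last first.
    by apply/funext => h /=; rewrite -scalerBl scalerA.
  have exk' : (fun h => h^-1 *: ((k \o shift x) (h *: v) - k x)) @ 0^' -->
    'D_v k x by exact: exk.
  exact: (cvg_comp _ _ exk' (@scalel_continuous _ _ w ('D_v k x))).
by apply: DeriveDef; [apply/cvg_ex; exists ('D_v k x *: w)|exact: cvg_lim].
Qed.

(** Expansion in the standard basis reduces everything to scalar coordinates times fixed vectors, so
    l can be a bare function whose linearity is a hypothesis. *)
Lemma is_derive_rVlinear (V W : normedModType R) m (l : 'rV[R]_m -> W)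
    (f : V -> 'rV[R]_m) x v df :
  linear l -> is_derive x v f df -> is_derive x v (fun y => l (f y)) (l df).
Proof.
move=> ll Hf; pose lb := GRing.isLinear.Build R _ _ _ l ll.
pose L : {linear 'rV[R]_m -> W} := HB.pack l lb.
have lE u : l u = \sum_i u 0 i *: l 'e_i.
  rewrite -[LHS]/(L u) [u in LHS]row_sum_delta linear_sum.
  by apply: eq_bigr => i _; rewrite linearZ.
rewrite [X in is_derive _ _ X _](_ : _ = \sum_i (fun y => f y 0 i *: l 'e_i));
  last by apply/funext => y; rewrite lE fct_sumE.
rewrite lE; apply: is_derive_sum => i.
exact: (is_derive_scalev _ (is_derive_coord 0 i Hf)).
Qed.

Lemma differentiable_rVlinear m (W : normedModType R)
    (l : 'rV[R]_m -> W) x :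
  linear l -> differentiable l x.
Proof.
move=> ll; pose L : {linear 'rV[R]_m -> W} :=
  HB.pack l (GRing.isLinear.Build R _ _ _ l ll).
have -> : l = \sum_i (fun u : 'rV[R]_m => u 0 i *: l 'e_i).
  apply/funext => u; rewrite fct_sumE -[LHS]/(L u) [u in LHS]row_sum_delta linear_sum.
  by apply: eq_bigr => i _; rewrite linearZ.
apply: differentiable_sum => i; apply: differentiableZl.
exact: differentiable_coord.
Qed.

Lemma is_derive_bilinear (V W : normedModType R) m n
    (b : 'rV[R]_m -> 'rV[R]_n -> W) (f : V -> 'rV[R]_m) (g : V -> 'rV[R]_n)
    x v df dg :
  (forall u, linear (b u)) -> (forall u, linear (b^~ u)) ->
  is_derive x v f df -> is_derive x v g dg ->
  is_derive x v (fun y => b (f y) (g y)) (b df (g x) + b (f x) dg).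
Proof.
move=> lr ll Hf Hg.
pose br u := GRing.isLinear.Build R _ _ _ (b u) (lr u).
pose bR u : {linear 'rV[R]_n -> W} := HB.pack (b u) (br u).
pose bl u := GRing.isLinear.Build R _ _ _ (b^~ u) (ll u).
pose bL u : {linear 'rV[R]_m -> W} := HB.pack (b^~ u) (bl u).
have bE u w : b u w = \sum_i \sum_j (u 0 i * w 0 j) *: b 'e_i 'e_j.
  rewrite -[LHS]/(bL w u) [u in LHS]row_sum_delta linear_sum.
  apply: eq_bigr => i _; rewrite linearZ /= -[b _ _]/(bR 'e_i w).
  rewrite [w in LHS]row_sum_delta linear_sum scaler_sumr.
  by apply: eq_bigr => j _; rewrite linearZ /= scalerA.
rewrite [X in is_derive _ _ X _](_ : _ = \sum_i \sum_j
    (fun y => (f y 0 i * g y 0 j) *: b 'e_i 'e_j)); last first.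
  apply/funext => y; rewrite bE fct_sumE; apply: eq_bigr => i _.
  by rewrite fct_sumE.
rewrite !bE -big_split /=; apply: is_derive_sum => i.
rewrite -big_split /=; apply: is_derive_sum => j.
rewrite -scalerDl.
have Hi := is_derive_coord 0 i Hf; have Hj := is_derive_coord 0 j Hg.
apply: (@is_derive_scalev V W (fun y => f y 0 i * g y 0 j)).
by apply: is_derive_eq; rewrite addrC /GRing.scale /= [_ * df _ _]mulrC.
Qed.

Lemma is_derive_line (V W : normedModType R) (f : V -> W) x v df :
  is_derive x v f df <-> is_derive (0 : R) 1 (fun h => f (h *: v + x)) df.
Proof.
have dE : 'D_v f x = 'D_1 (fun h : R => f (h *: v + x)) 0.
  rewrite /derive; congr (lim _); apply/funext => P /=.
  rewrite /fmap /=; congr (nbhs _ (_ @^-1` P)); apply/funext => h /=.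
  by rewrite scale0r add0r addr0 -[h%:A]/(h * 1) mulr1.
by split=> -[exf <-]; apply: DeriveDef; rewrite ?dE//;
  [move/(derivable1P f x v): exf|apply/(derivable1P f x v)].
Qed.

(** On the line through x with direction v this is the chain rule in one variable; of g it uses only
    the derivative along v. *)
Lemma is_derive_chain (V : normedModType R) (f : R -> R) (g : V -> R) x v df dg :
  is_derive (g x) 1 f df -> is_derive x v g dg ->
  is_derive x v (fun y => f (g y)) (df * dg).
Proof.
move=> Hf /is_derive_line Hg; apply/is_derive_line.
apply: (@is_derive1_comp _ f (fun h => g (h *: v + x))) => //.
by rewrite scale0r add0r.
Qed.

End Calculus.

(** * Functions of class C^k on an open set *)

Section Ck_theory.
Context {R : realType} {m : nat}.
Variable U : set 'rV[R]_m.
Hypothesis oU : open U.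
Implicit Types f g : 'rV[R]_m -> R.

Lemma CkW k f : Ck k.+1 U f -> Ck k U f.
Proof.
elim: k f => [|k IHk] f; first by case.
by case=> cf df; split=> // i; have [dfi /IHk] := df i.
Qed.

Lemma near_open_eq f g x : (forall y, U y -> f y = g y) -> U x ->
  \near x, f x = g x.
Proof.
by move=> fg Ux; apply: filterS (open_nbhs_nbhs (conj oU Ux)) => y; exact: fg.
Qed.

Lemma continuous_eq f g : (forall x, U x -> f x = g x) ->
  (forall x, U x -> {for x, continuous f}) ->
  forall x, U x -> {for x, continuous g}.
Proof.
move=> fg cf x Ux; rewrite /prop_for /continuous_at -fg//.
apply: cvg_trans (cf x Ux); apply: (@near_eq_cvg _ _ (nbhs x) _ f g).
by apply: filterS (open_nbhs_nbhs (conj oU Ux)) => y Uy; exact: fg.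
Qed.

(** A partial derivative at x depends on a neighbourhood of x, and openness keeps that neighbourhood
    inside U. The closure properties below rely on this to replace partial derivatives by their
    formulas. *)
Lemma Ck_eq k f g : (forall x, U x -> f x = g x) -> Ck k U f -> Ck k U g.
Proof.
elim: k f g => [|k IHk] f g fg [cf df].
  by split=> //; exact: continuous_eq cf.
split=> [|i]; first exact: continuous_eq cf.
have [dfi Cfi] := df i; split=> [x Ux|].
  by apply: near_eq_derivable (dfi x Ux); exact: near_open_eq.
apply: IHk Cfi => x Ux; rewrite /partial; apply: near_eq_derive.
exact: near_open_eq.
Qed.

Lemma Ck_cst k c : Ck k U (fun=> c).
Proof.
elim: k c => [|k IHk] c; first by split=> // x _; exact: cst_continuous.
split=> [x _|i]; first exact: cst_continuous.
split=> [x _|]; first exact: derivable_cst.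
by apply: Ck_eq (IHk 0) => x _; rewrite /partial derive_cst.
Qed.

Lemma CkD k f g : Ck k U f -> Ck k U g -> Ck k U (fun x => f x + g x).
Proof.
elim: k f g => [|k IHk] f g [cf df] [cg dg].
  split=> // x Ux; exact: (cvgD (cf x Ux) (cg x Ux)).
split=> [x Ux|i]; first exact: (cvgD (cf x Ux) (cg x Ux)).
have [dfi Cfi] := df i; have [dgi Cgi] := dg i; split=> [x Ux|].
  exact: (derivableD (dfi x Ux) (dgi x Ux)).
apply: Ck_eq (IHk _ _ Cfi Cgi) => x Ux.
by rewrite /partial (deriveD (dfi x Ux) (dgi x Ux)).
Qed.

Lemma CkM k f g : Ck k U f -> Ck k U g -> Ck k U (fun x => f x * g x).
Proof.
elim: k f g => [|k IHk] f g Cf Cg; have [cf df] := Cf; have [cg dg] := Cg.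
  split=> // x Ux; exact: (cvgM (cf x Ux) (cg x Ux)).
split=> [x Ux|i]; first exact: (cvgM (cf x Ux) (cg x Ux)).
have [dfi Cfi] := df i; have [dgi Cgi] := dg i; split=> [x Ux|].
  exact: (derivableM (dfi x Ux) (dgi x Ux)).
apply: Ck_eq (CkD (IHk _ _ (CkW Cf) Cgi) (IHk _ _ (CkW Cg) Cfi)) => x Ux.
by rewrite /partial (deriveM (dfi x Ux) (dgi x Ux)).
Qed.

Lemma Ck_sum k n (F : 'I_n -> 'rV[R]_m -> R) :
  (forall i, Ck k U (F i)) -> Ck k U (fun x => \sum_i F i x).
Proof.
elim: n F => [|n IHn] F CF.
  by apply: Ck_eq (Ck_cst k 0) => x _; rewrite big_ord0.
apply: Ck_eq (CkD (IHn (fun i => F (widen_ord (leqnSn n) i)) _) (CF ord_max)) => //.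
by move=> x _; rewrite big_ord_recr.
Qed.

Lemma Ck_coord k j : Ck k U (fun x => x 0 j).
Proof.
have dj (i : 'I_m) (x : 'rV[R]_m) : is_derive x ('e_i : 'rV[R]_m)
    (fun x : 'rV[R]_m => x 0 j) (('e_i : 'rV[R]_m) 0 j).
  exact: (is_derive_coord 0 j (is_derive_id x _)).
case: k => [|k]; first by split=> // x _; exact: coord_continuous.
split=> [x _|i]; first exact: coord_continuous.
split=> [x _|]; first by have := dj i x; case.
by apply: Ck_eq (Ck_cst k (('e_i : 'rV[R]_m) 0 j)) => x _; have [_ <-] := dj i x.
Qed.

Lemma Ck_linear k (l : 'rV[R]_m -> R) : scalar l -> Ck k U l.
Proof.
move=> ll; pose lb := GRing.isLinear.Build R _ _ _ l ll.
pose L : {scalar 'rV[R]_m} := HB.pack l lb.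
apply: (Ck_eq (f := fun x => \sum_i x 0 i * l 'e_i)).
  move=> x _; rewrite -[l x]/(L x) [in RHS](row_sum_delta x) linear_sum.
  by apply: eq_bigr => i _; rewrite linearZ.
by apply: Ck_sum => i; apply: CkM; [exact: Ck_coord|exact: Ck_cst].
Qed.

Lemma Ck_quadratic k (b : 'rV[R]_m -> 'rV[R]_m -> R) :
  (forall u, scalar (b u)) -> (forall u, scalar (b^~ u)) ->
  Ck k U (fun x => b x x).
Proof.
move=> lr ll; apply: (Ck_eq (f := fun x => \sum_i x 0 i * b x 'e_i)).
  move=> x _; pose lb := GRing.isLinear.Build R _ _ _ (b x) (lr x).
  pose L : {scalar 'rV[R]_m} := HB.pack (b x) lb.
  rewrite -[b x x]/(L x) [in RHS](row_sum_delta x) linear_sum.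
  by apply: eq_bigr => i _; rewrite linearZ.
apply: Ck_sum => i; apply: CkM; first exact: Ck_coord.
exact: Ck_linear.
Qed.

Lemma Ck_inv k f : (forall x, U x -> f x != 0) -> Ck k U f ->
  Ck k U (fun x => (f x)^-1).
Proof.
move=> f0; elim: k => [|k IHk] Cf; have [cf df] := Cf.
  split=> // x Ux; exact: (cvgV (f0 x Ux) (cf x Ux)).
split=> [x Ux|i]; first exact: (cvgV (f0 x Ux) (cf x Ux)).
have [dfi Cfi] := df i; split=> [x Ux|].
  exact: (derivableV (f0 x Ux) (dfi x Ux)).
have Ci := IHk (CkW Cf).
apply: Ck_eq (CkM (Ck_cst k (-1)) (CkM (CkM Ci Ci) Cfi)) => x Ux.
by rewrite /partial (deriveV (f0 x Ux) (dfi x Ux)) mulN1r /GRing.scale /= mulNr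
   expr2 invfM.
Qed.

Lemma convex_connected : U !=set0 ->
  (forall x y (t : R), U x -> U y -> 0 <= t <= 1 -> U (x + t *: (y - x))) ->
  connected U.
Proof.
move=> [x0 Ux0] cU.
rewrite (_ : U = \bigcup_(y in U) ((fun t : R => x0 + t *: (y - x0)) @` `[0, 1])).
  apply: bigcup_connected.
    by exists x0 => y _; exists 0; rewrite ?scale0r ?addr0//= in_itv/= lexx ler01.
  move=> y Uy; apply: connected_continuous_connected; first exact: segment_connected.
  apply: continuous_subspaceT => t; apply: cvgD; first exact: cvg_cst.
  exact: scalel_continuous.
apply/seteqP; split=> [y Uy|y [z Uz] [t]].
  exists y => //; exists 1; first by rewrite /= in_itv/= ler01 lexx.
  by rewrite scale1r addrC subrK.
by rewrite /= in_itv/= => t01 <-; apply: cU.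
Qed.

End Ck_theory.

(** * Matrices and traces *)

Section Matrices.
Context {F : fieldType}.

(** Sylvester's identity: block elimination of the matrix with rows (1, -A) and (B, 1), carried out
    in two ways. *)
Lemma det_1mulmx m n (A : 'M[F]_(m, n)) (B : 'M[F]_(n, m)) :
  \det (1%:M + A *m B) = \det (1%:M + B *m A).
Proof.
have E1 : block_mx 1%:M (- A) 0 1%:M *m block_mx (1%:M + A *m B) 0 B 1%:M =
    block_mx 1%:M (- A) B 1%:M.
  by rewrite mulmx_block !mul1mx !mulmx1 !mul0mx !mulNmx !add0r addrK.
have E2 : block_mx 1%:M 0 B 1%:M *m block_mx 1%:M (- A) 0 (1%:M + B *m A) =
    block_mx 1%:M (- A) B 1%:M.
  by rewrite mulmx_block !mulmx1 !mul1mx !mul0mx !mulmxN !addr0 addrC addrK.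
have := congr1 determinant E1; rewrite -{1}E2.
by rewrite !det_mulmx !det_ublock !det_lblock !det1 !mul1r !mulr1 => ->.
Qed.

(** In a rank factorization A has full column rank and B full row rank, so both cancel from A B A B
    = A B. Exchanging A B for B A then turns traces and determinants involving P into those of
    scalar matrices of size [\rank P]. *)
Lemma idempotent_factor n (P : 'M[F]_n) : P *m P = P ->
  exists (A : 'M[F]_(n, \rank P)) (B : 'M[F]_(\rank P, n)),
    P = A *m B /\ B *m A = 1%:M.
Proof.
move=> PP; exists (col_base P), (row_base P); split; first by rewrite mulmx_base.
apply: (row_full_inj (col_base_full P)); apply: (row_free_inj (row_base_free P)).
rewrite /= mulmx1; transitivity (col_base P *m row_base P *m (col_base P *m row_base P)).
  by rewrite !mulmxA.
by rewrite (mulmx_base P).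
Qed.

Lemma trace_idempotent n (P : 'M[F]_n) : P *m P = P -> \tr P = (\rank P)%:R.
Proof.
case/idempotent_factor=> A [B [PE BA]].
by rewrite [in LHS]PE mxtrace_mulC BA mxtrace1.
Qed.

Lemma det_1idempotent n (P : 'M[F]_n) c : P *m P = P ->
  \det (1%:M + c *: P) = (1 + c) ^+ \rank P.
Proof.
case/idempotent_factor=> A [B [PE BA]]; rewrite [in LHS]PE scalemxAl det_1mulmx.
by rewrite -scalemxAr BA -{1}[1%:M]scale1r -scalerDl detZ det1 mulr1.
Qed.

Lemma mx_eq_forms m (A B : 'M[F]_m) :
  (forall u w : 'rV_m, (u *m A *m w^T) 0 0 = (u *m B *m w^T) 0 0) -> A = B.
Proof.
move=> H; apply/matrixP => i j; have := H 'e_i 'e_j.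
rewrite !trmx_delta -!rowE -!colE !mxE => <-//.
Qed.

Definition gram m (b : 'rV[F]_m -> 'rV[F]_m -> F) : 'M[F]_m :=
  \matrix_(i, j) b 'e_i 'e_j.

Lemma gramE m (b : 'rV[F]_m -> 'rV[F]_m -> F) :
  (forall u, scalar (b u)) -> (forall u, scalar (b^~ u)) ->
  forall u w, (u *m gram b *m w^T) 0 0 = b u w.
Proof.
move=> lr ll u w.
pose lbl w := GRing.isLinear.Build F _ _ _ (b^~ w) (ll w).
pose L w : {scalar 'rV[F]_m} := HB.pack (b^~ w) (lbl w).
pose lbr w := GRing.isLinear.Build F _ _ _ (b w) (lr w).
pose Rr w : {scalar 'rV[F]_m} := HB.pack (b w) (lbr w).
rewrite -[RHS]/(L w u) [in RHS](row_sum_delta u) linear_sum.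
rewrite -mulmxA mxE; apply: eq_bigr => i _; rewrite linearZ /=; congr (_ * _).
rewrite -[RHS]/(Rr 'e_i w) [in RHS](row_sum_delta w) linear_sum mxE.
by apply: eq_bigr => j _; rewrite linearZ !mxE mulrC.
Qed.

Lemma posdef_unitmx (R : numFieldType) m (A : 'M[R]_m) :
  (forall u : 'rV_m, u != 0 -> 0 < (u *m A *m u^T) 0 0) -> A \in unitmx.
Proof.
move=> H; rewrite -row_free_unit; apply: inj_row_free => v vA.
by apply/eqP/contraT => /H; rewrite vA mul0mx mxE ltxx.
Qed.

End Matrices.

(** * Traces of linear maps given as functions *)

Section FunTrace.
Context {R : fieldType} {N : nat}.
Implicit Types f g : 'rV[R]_N -> 'rV[R]_N.

(** The sum of diagonal entries is kept in the shape in which a divergence produces it, and can be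
    split before any map is packed as linear. *)
Definition ftrace f : R := \sum_i f 'e_i 0 i.

Lemma ftraceD f g : ftrace (fun w => f w + g w) = ftrace f + ftrace g.
Proof. by rewrite /ftrace -big_split; apply: eq_bigr => i _; rewrite mxE. Qed.

Lemma ftraceZ c f : ftrace (fun w => c *: f w) = c * ftrace f.
Proof. by rewrite /ftrace mulr_sumr; apply: eq_bigr => i _; rewrite mxE. Qed.

Lemma eq_ftrace f g : f =1 g -> ftrace f = ftrace g.
Proof. by move=> fg; apply: eq_bigr => i _; rewrite fg. Qed.

Lemma ftrace0 f : (forall w, f w = 0) -> ftrace f = 0.
Proof. by move=> f0; apply: big1 => i _; rewrite f0 mxE. Qed.

Lemma ftrace_mulmx A : ftrace (fun w => w *m A) = \tr A.
Proof. by apply: eq_bigr => i _; rewrite -rowE mxE. Qed.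

Lemma ftrace_rank1 (l : 'rV[R]_N -> R) y : scalar l ->
  ftrace (fun w => l w *: y) = l y.
Proof.
move=> ll; pose lb := GRing.isLinear.Build R _ _ _ l ll.
pose L : {scalar 'rV[R]_N} := HB.pack l lb.
rewrite -[RHS]/(L y) [in RHS](row_sum_delta y) linear_sum.
by apply: eq_bigr => i _; rewrite linearZ mxE mulrC.
Qed.

Lemma lin1_mxP f : linear f -> forall u, u *m lin1_mx f = f u.
Proof.
move=> lf u; pose lb := GRing.isLinear.Build R _ _ _ f lf.
pose L : {linear 'rV[R]_N -> 'rV[R]_N} := HB.pack f lb.
exact: (mul_rV_lin1 L).
Qed.

Lemma ftraceC f g : linear f -> linear g ->
  ftrace (fun w => f (g w)) = ftrace (fun w => g (f w)).
Proof.
move=> lf lg.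
rewrite (@eq_ftrace _ (fun w => w *m (lin1_mx g *m lin1_mx f))); last first.
  by move=> w; rewrite mulmxA !lin1_mxP.
rewrite (@eq_ftrace (fun w => g (f w)) (fun w => w *m (lin1_mx f *m lin1_mx g))).
  by rewrite !ftrace_mulmx mxtrace_mulC.
by move=> w; rewrite mulmxA !lin1_mxP.
Qed.

End FunTrace.

(** * H-type algebras in coordinates *)

(* An H-type algebra in linear coordinates: [pv] is the orthogonal projection
   onto the complement of the center, and [Jmap z x] is J_z x. *)
Record htype (R : realType) (N : nat) := Htype {
  ip : 'rV[R]_N -> 'rV[R]_N -> R;
  br : 'rV[R]_N -> 'rV[R]_N -> 'rV[R]_N;
  Jmap : 'rV[R]_N -> 'rV[R]_N -> 'rV[R]_N;
  pv : 'M[R]_N;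
  ip_scalarl : forall w, scalar (ip^~ w);
  ipC : forall u w, ip u w = ip w u;
  ip_gt0 : forall u, u != 0 -> 0 < ip u u;
  br_linearl : forall w, linear (br^~ w);
  br_linearr : forall w, linear (br w);
  br_alt : forall u, br u u = 0;
  Jm_linearl : forall x, linear (Jmap^~ x);
  Jm_linearr : forall z, linear (Jmap z);
  pv_idem : pv *m pv = pv;
  ip_pv : forall u w, ip (u *m pv) w = ip u (w *m pv);
  br_pvl : forall u w, br (u *m pv) w = br u w;
  br_z : forall u w, br u w *m pv = 0;
  ip_Jm : forall z x y, ip (Jmap z x) y = ip (br x y) z;
  JmK : forall z x, z *m pv = 0 -> x *m pv = x ->
    Jmap z (Jmap z x) = - ip z z *: x }.

Section HtypeTheory.
Context {R : realType} {N : nat} (h : htype R N).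
Implicit Types (u v w x y z : 'rV[R]_N) (c : R).
Local Notation "''[' u , v ]" := (ip h u v).
Local Notation "''[' u ]" := (ip h u u).
Local Notation br := (br h).
Local Notation J := (Jmap h).
Local Notation pv := (pv h).
Local Notation pz := (1%:M - pv).

Lemma ipDl u v w : '[u + v, w] = '[u, w] + '[v, w].
Proof. by have := ip_scalarl h w 1 u v; rewrite scale1r mul1r. Qed.
Lemma ip0l w : '[0, w] = 0.
Proof. by apply/eqP; rewrite -[_ == 0](inj_eq (addrI '[0, w])) addr0 -ipDl addr0. Qed.
Lemma ipZl c u w : '[c *: u, w] = c * '[u, w].
Proof. by have := ip_scalarl h w c u 0; rewrite ip0l !addr0. Qed.
Lemma ipNl u w : '[- u, w] = - '[u, w].
Proof. by rewrite -scaleN1r ipZl mulN1r. Qed.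
Lemma ipDr u v w : '[w, u + v] = '[w, u] + '[w, v].
Proof. by rewrite ![ip h w _]ipC ipDl. Qed.
Lemma ip0r w : '[w, 0] = 0.
Proof. by rewrite ipC ip0l. Qed.
Lemma ipZr c u w : '[w, c *: u] = c * '[w, u].
Proof. by rewrite ![ip h w _]ipC ipZl. Qed.
Lemma ipNr u w : '[w, - u] = - '[w, u].
Proof. by rewrite ![ip h w _]ipC ipNl. Qed.
Definition ipE := (ipDl, ipDr, ipNl, ipNr, ipZl, ipZr, ip0l, ip0r).

Lemma ip_ge0 u : 0 <= '[u].
Proof. by have [->|/(ip_gt0 h)/ltW//] := eqVneq u 0; rewrite ip0l. Qed.

Lemma ip_eq0 u : ('[u] == 0) = (u == 0).
Proof.
apply/idP/idP => [/eqP u0|/eqP ->]; last by rewrite ip0l.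
by apply: contraT => /(ip_gt0 h); rewrite u0 ltxx.
Qed.

Lemma ip_inj u v : (forall w, '[u, w] = '[v, w]) -> u = v.
Proof.
move=> H; apply/eqP; rewrite -subr_eq0 -ip_eq0 ipDl ipNl H.
by rewrite subrr.
Qed.

Lemma brDl u v w : br (u + v) w = br u w + br v w.
Proof. by have := br_linearl h w 1 u v; rewrite !scale1r. Qed.
Lemma br0l w : br 0 w = 0.
Proof. by apply: (addrI (br 0 w)); rewrite -brDl !addr0. Qed.
Lemma brZl c u w : br (c *: u) w = c *: br u w.
Proof. by have := br_linearl h w c u 0; rewrite br0l !addr0. Qed.
Lemma brNl u w : br (- u) w = - br u w.
Proof. by rewrite -scaleN1r brZl scaleN1r. Qed.
Lemma brDr u v w : br w (u + v) = br w u + br w v.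
Proof. by have := br_linearr h w 1 u v; rewrite !scale1r. Qed.
Lemma br0r w : br w 0 = 0.
Proof. by apply: (addrI (br w 0)); rewrite -brDr !addr0. Qed.
Lemma brZr c u w : br w (c *: u) = c *: br w u.
Proof. by have := br_linearr h w c u 0; rewrite br0r !addr0. Qed.
Lemma brNr u w : br w (- u) = - br w u.
Proof. by rewrite -scaleN1r brZr scaleN1r. Qed.
Definition brE := (brDl, brDr, brNl, brNr, brZl, brZr, br0l, br0r, br_alt h).

Lemma brC u w : br u w = - br w u.
Proof.
apply/eqP; rewrite -addr_eq0; have := br_alt h (u + w).
by rewrite brDl !brDr !br_alt add0r addr0 => ->.
Qed.

Lemma br_pvr u w : br u (w *m pv) = br u w.
Proof. by rewrite brC br_pvl -brC. Qed.

Lemma JmDl u v w : J (u + v) w = J u w + J v w.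
Proof. by have := Jm_linearl h w 1 u v; rewrite !scale1r. Qed.
Lemma Jm0l w : J 0 w = 0.
Proof. by apply: (addrI (J 0 w)); rewrite -JmDl !addr0. Qed.
Lemma JmZl c u w : J (c *: u) w = c *: J u w.
Proof. by have := Jm_linearl h w c u 0; rewrite Jm0l !addr0. Qed.
Lemma JmNl u w : J (- u) w = - J u w.
Proof. by rewrite -scaleN1r JmZl scaleN1r. Qed.
Lemma JmDr u v w : J w (u + v) = J w u + J w v.
Proof. by have := Jm_linearr h w 1 u v; rewrite !scale1r. Qed.
Lemma Jm0r w : J w 0 = 0.
Proof. by apply: (addrI (J w 0)); rewrite -JmDr !addr0. Qed.
Lemma JmZr c u w : J w (c *: u) = c *: J w u.
Proof. by have := Jm_linearr h w c u 0; rewrite Jm0r !addr0. Qed.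
Lemma JmNr u w : J w (- u) = - J w u.
Proof. by rewrite -scaleN1r JmZr scaleN1r. Qed.
Definition JmapE := (JmDl, JmDr, JmNl, JmNr, JmZl, JmZr, Jm0l, Jm0r).

Lemma pzE u : u *m pz = u - u *m pv.
Proof. by rewrite mulmxBr mulmx1. Qed.

Lemma pz_pv u : u *m pz *m pv = 0.
Proof. by rewrite pzE mulmxBl -mulmxA pv_idem subrr. Qed.

Lemma ip_vz u w : u *m pv = u -> w *m pv = 0 -> '[u, w] = 0.
Proof. by move=> <- w0; rewrite ip_pv w0 ip0r. Qed.

Lemma Jm_pv z x : J z x *m pv = J z x.
Proof. by apply: (ip_inj) => w; rewrite ip_pv !ip_Jm br_pvr. Qed.

Lemma ip_JmC z x y : '[J z x, y] = - '[x, J z y].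
Proof. by rewrite [ip h x _]ipC !ip_Jm brC ipNl. Qed.

Lemma ip_Jm_id z x : '[J z x, x] = 0.
Proof. by rewrite ip_Jm br_alt ip0l. Qed.

Lemma ip_JmJm z x : z *m pv = 0 -> x *m pv = x ->
  '[J z x] = '[z] * '[x].
Proof. by move=> z0 xv; rewrite ip_JmC JmK// ipZr mulNr opprK. Qed.

(** Polarizing |J_z x|^2 = |z|^2 |x|^2 in z gives <J_y x, J_z x> = <y, z> |x|^2 for central y, and
    the left side is <[x, J_z x], y> by the definition of J_y. *)
Lemma br_Jm z x : z *m pv = 0 -> x *m pv = x -> br x (J z x) = '[x] *: z.
Proof.
move=> z0 xv; apply: ip_inj => w.
have wE : w = w *m pv + w *m pz by rewrite pzE addrC subrK.
have -> : '[br x (J z x), w] = '[br x (J z x), w *m pz].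
  by rewrite {1}wE ipDr [X in X + _]ipC (ip_vz _ (br_z h _ _)) ?add0r//
    -mulmxA pv_idem.
rewrite -ip_Jm ipZl; have -> : '[z, w] = '[z, w *m pz].
  by rewrite {1}wE ipDr [X in X + _]ipC (ip_vz _ z0) ?add0r// -mulmxA pv_idem.
have y0 := pz_pv w; move: (w *m pz) y0 => y y0.
have := @ip_JmJm (y + z) x; rewrite mulmxDl y0 z0 addr0 => /(_ erefl xv).
rewrite JmDl !ipE !ip_JmJm// [ip h (J z x) _]ipC [ip h y z]ipC.
by move=> H; lra.
Qed.

(** J_z is skew for the inner product. With S the Gram matrix this reads A S = - S A^T, so A is
    similar to - A^T and its trace is its own opposite. *)
Lemma ftrace_Jm z : ftrace (J z) = 0.
Proof.
pose S := gram (ip h); pose A := lin1_mx (J z).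
have SE u w : (u *m S *m w^T) 0 0 = '[u, w].
  by apply: gramE => v; [move=> c x y; rewrite ipDr ipZr|exact: ip_scalarl].
have AE u : u *m A = J z u by apply: lin1_mxP; exact: Jm_linearr.
have Su : S \in unitmx.
  by apply: posdef_unitmx => u u0; rewrite SE; exact: ip_gt0.
have AS : A *m S = - (S *m A^T).
  apply: mx_eq_forms => u w; rewrite mulmxA AE SE ip_JmC -SE mulmxN mulNmx.
  by rewrite [RHS]mxE; congr (- _); rewrite -AE trmx_mul !mulmxA.
have trA : \tr A = - \tr A.
  rewrite -{1}[A](mulmxK Su) AS mulNmx linearN /= mxtrace_mulC mulmxA.
  by rewrite mulVmx// mul1mx mxtrace_tr.
rewrite (@eq_ftrace _ _ _ (fun w => w *m A))// ftrace_mulmx.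
by apply/eqP; rewrite -[_ == 0](mulrn_eq0 _ 2) mulr2n {1}trA addNr.
Qed.

End HtypeTheory.

(** * The metric and the radial function *)

Section Chart.
Context {R : realType} {N : nat} (h : htype R N).
Implicit Types (x y u w p : 'rV[R]_(1 + N)) (v z : 'rV[R]_N) (c : R).
Local Notation "''[' u , v ]" := (ip h u v).
Local Notation "''[' u ]" := (ip h u u).
Local Notation br := (br h).
Local Notation J := (Jmap h).
Local Notation pv := (pv h).
Local Notation pz := (1%:M - pv).

(** The chart lists a before X + Z: [ht] is the height a and [nl] the nilpotent part X + Z. *)
Definition ht x : R := lsubmx x 0 0.
Definition nl x : 'rV[R]_N := rsubmx x.
Definition mkpt (a : R) (v : 'rV[R]_N) : 'rV[R]_(1 + N) := row_mx a%:M v.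

Lemma ht_mkpt a v : ht (mkpt a v) = a.
Proof. by rewrite /ht /mkpt row_mxKl mxE eqxx. Qed.
Lemma nl_mkpt a v : nl (mkpt a v) = v.
Proof. by rewrite /nl /mkpt row_mxKr. Qed.
Lemma mkpt_eta x : mkpt (ht x) (nl x) = x.
Proof. by rewrite /mkpt /ht /nl -mx11_scalar hsubmxK. Qed.
Lemma htP c x y : ht (c *: x + y) = c * ht x + ht y.
Proof. by rewrite /ht linearP !mxE. Qed.
Lemma htZ c x : ht (c *: x) = c * ht x.
Proof. by rewrite /ht linearZ /= [LHS]mxE. Qed.
Lemma nlP c x y : nl (c *: x + y) = c *: nl x + nl y.
Proof. exact: linearP. Qed.

Lemma mkptP c a b (v w : 'rV[R]_N) : mkpt (c * a + b) (c *: v + w) = c *: mkpt a v + mkpt b w.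
Proof. by rewrite /mkpt scale_row_mx add_row_mx scale_scalar_mx -raddfD. Qed.

Lemma mkptZ c a (v : 'rV[R]_N) : c *: mkpt a v = mkpt (c * a) (c *: v).
Proof. by rewrite /mkpt scale_row_mx scale_scalar_mx. Qed.

Lemma mkptD a b (v w : 'rV[R]_N) : mkpt a v + mkpt b w = mkpt (a + b) (v + w).
Proof. by rewrite /mkpt add_row_mx -raddfD. Qed.

Definition half_space : set 'rV[R]_(1 + N) := [set x | 0 < ht x].

Lemma ht_continuous : continuous ht.
Proof.
move=> x; rewrite (_ : ht = fun x => x 0 (lshift N 0)); first exact: coord_continuous.
by apply/funext => y; rewrite /ht mxE.
Qed.

Lemma open_half_space : open half_space.
Proof.
apply: (@open_comp _ _ ht [set c | 0 < c]); last exact: open_gt.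
by move=> x _; apply: ht_continuous.
Qed.

Lemma connected_half_space : connected half_space.
Proof.
apply: convex_connected.
  by exists (mkpt 1 0); rewrite /half_space /= ht_mkpt.
move=> x y t; rewrite /half_space /= => x0 y0 /andP[t0 t1].
rewrite addrC htP (_ : y - x = -1 *: x + y) ?htP; last by rewrite scaleN1r addrC.
have -> : t * (-1 * ht x + ht y) + ht x = (1 - t) * ht x + t * ht y by ring.
have [->|tn0] := eqVneq t 0; first by rewrite subr0 mul1r mul0r addr0.
have t0' : 0 < t by rewrite lt_neqAle eq_sym tn0.
by rewrite ltr_wpDl ?mulr_ge0 ?subr_ge0 ?(ltW x0) ?mulr_gt0.
Qed.

(* The z-component, in the left-invariant frame at x, of a times the tangent
   vector u. *)
Definition zframe x u : 'rV[R]_N := nl u *m pz - 2^-1 *: br (nl x) (nl u).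

(** The left-invariant metric in closed form: translation to the identity divides the v-part by
    a^(1/2), and the central part and the height by a. The agreement with [s_metric] is
    [s_metricE]. *)
Definition gform x u w : R :=
  (ht x)^-1 * '[nl u *m pv, nl w *m pv] +
  (ht x)^-1 ^+ 2 * ('[zframe x u, zframe x w] + ht u * ht w).

Lemma zframe_linear x : linear (zframe x).
Proof.
move=> c u w; rewrite /zframe nlP mulmxDl -scalemxAl brDr brZr scalerDr scalerBr.
by rewrite !scalerA mulrC opprD addrACA.
Qed.

Lemma gformC x u w : gform x u w = gform x w u.
Proof. by rewrite /gform ipC [ip h (zframe x u) _]ipC [ht u * _]mulrC. Qed.

Lemma gform_scalarl x w : scalar (gform x ^~ w).
Proof.
move=> c u u'; rewrite /gform zframe_linear htP nlP mulmxDl -scalemxAl !ipE.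
by ring.
Qed.

Lemma gform_scalarr x w : scalar (gform x w).
Proof. by move=> c u u'; rewrite gformC gform_scalarl ![gform x _ w]gformC. Qed.

Lemma gform_scaleZ x c u : gform x (c *: u) (c *: u) = c ^+ 2 * gform x u u.
Proof.
have E0 y : gform x 0 y = 0.
  by have := gform_scalarl x y (-1) 0 0; rewrite scaler0 addr0 mulN1r addNr.
have E y : gform x (c *: u) y = c * gform x u y.
  by have := gform_scalarl x y c u 0; rewrite addr0 E0 addr0.
by rewrite E gformC E expr2 mulrA.
Qed.

Lemma gform_gt0 x u : half_space x -> u != 0 -> 0 < gform x u u.
Proof.
rewrite /half_space /= => x0 u0; rewrite lt_neqAle eq_sym; apply/andP; split; last first.
  by rewrite addr_ge0 ?mulr_ge0 ?addr_ge0 ?ip_ge0 ?invr_ge0 ?exprn_ge0 ?invr_ge0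
    ?(ltW x0)// -expr2 sqr_ge0.
apply: contraNneq u0 => /eqP.
rewrite paddr_eq0 ?mulr_ge0 ?addr_ge0 ?ip_ge0 ?exprn_ge0 ?invr_ge0 ?(ltW x0)//;
  last by rewrite -expr2 sqr_ge0.
have xi : 0 < (ht x)^-1 by rewrite invr_gt0.
rewrite mulf_eq0 (gt_eqF xi) /= mulf_eq0 (gt_eqF (exprn_gt0 2 xi)) /=.
rewrite -expr2 paddr_eq0 ?ip_ge0 ?sqr_ge0// !ip_eq0 sqrf_eq0.
move=> /andP[/eqP v0 /andP[/eqP z0 /eqP h0]].
have n0 : nl u = 0.
  have brn : br (nl x) (nl u) = 0 by rewrite -br_pvr v0 br0r.
  move: z0; rewrite /zframe brn scaler0 subr0 => z0.
  by rewrite -[nl u]mulmx1 -(subrK pv 1%:M) mulmxDr z0 v0 addr0.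
by rewrite -(mkpt_eta u) h0 n0 /mkpt raddf0 row_mx0.
Qed.

Lemma gform_ge0 x u : half_space x -> 0 <= gform x u u.
Proof.
move=> Ux; have [->|/(gform_gt0 Ux)/ltW//] := eqVneq u 0.
by have := gform_scalarl x 0 (-1) 0 0; rewrite scaler0 addr0 mulN1r addNr => ->.
Qed.

Lemma gform_CS x u w : half_space x -> gform x u w ^+ 2 <= gform x u u * gform x w w.
Proof.
move=> Ux; have [->|u0] := eqVneq u 0.
  have e : (0 : 'rV[R]_(1 + N)) = 0 *: 0 + 0 by rewrite scaler0 addr0.
  have E y : gform x 0 y = 0.
    by have := gform_scalarl x y (-1) 0 0; rewrite scaler0 addr0 mulN1r addNr.
  by rewrite !E expr0n mul0r.
have g0 := gform_gt0 Ux u0.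
set a := gform x u u in g0 *; set b := gform x u w; set d := gform x w w.
have := gform_ge0 (- (b / a) *: u + w) Ux; rewrite gform_scalarl !gform_scalarr.
rewrite [gform x w u]gformC -/a -/b -/d => H.
have -> : b ^+ 2 = a * d - a * (- (b / a) * (- (b / a) * a + b) + (- (b / a) * b + d)).
  by field; rewrite gt_eqF.
by rewrite gerBl mulr_ge0// ltW.
Qed.

Section Base.
Variable p : 'rV[R]_(1 + N).
Local Notation b := (ht p).

(* If x = (X, Z, a) and p = (X1, Z1, b), then p^-1 x has components
   Vp x / sqrt b, Zp x / b and a / b. *)
Definition Vp x := (nl x - nl p) *m pv.
Definition Zp x := (nl x - nl p) *m pz - 2^-1 *: br (nl p) (nl x).
Definition beta x := ht x + b + 4^-1 * '[Vp x].
Definition Nq x := beta x ^+ 2 + '[Zp x].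
(* [Qp x] is cosh^2 (d / 2), where d is the distance from x to p. *)
Definition Qp x := Nq x / (4 * ht x * b).
Definition dbeta x u := ht u + 2^-1 * '[Vp x, nl u].
(** The frame is taken at p and not at x: [Zp] is affine in x, and its linear part is [zframe] at
    p. *)
Definition dNq x u := 2 * beta x * dbeta x u + 2 * '[Zp x, zframe p u].
Definition dQp x u :=
  dNq x u / (4 * ht x * b) - Nq x * ht u / (4 * ht x ^+ 2 * b).

(** Up to the factor 1 / (4 b), [Wp] is the v-part of the gradient, [Yh] its height and [Yn] its
    nilpotent part. The bracket with [nl p] and the term |V|^2 / 2 in [Yn] compensate the bracket in
    [zframe] at x, because [V, W] = |V|^2 zeta; the frame component left is 2 a zeta. *)
Definition Wp x := beta x *: Vp x + J (Zp x) (Vp x).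
Definition Yh x := 2 * ht x * beta x - Nq x.
Definition Yn x :=
  Wp x + (2 * ht x + 2^-1 * '[Vp x]) *: Zp x + 2^-1 *: br (nl p) (Wp x).
(* The gradient of [Qp]. *)
Definition Yp x := (4 * b)^-1 *: mkpt (Yh x) (Yn x).

Lemma Vp_pv x : Vp x *m pv = Vp x.
Proof. by rewrite /Vp -mulmxA pv_idem. Qed.

Lemma Zp_pv x : Zp x *m pv = 0.
Proof. by rewrite /Zp mulmxBl pz_pv -scalemxAl br_z scaler0 subr0. Qed.

Lemma Wp_pv x : Wp x *m pv = Wp x.
Proof. by rewrite /Wp mulmxDl -scalemxAl Vp_pv Jm_pv. Qed.

Lemma br_nl x v : br (nl x) v = br (nl p) v + br (Vp x) v.
Proof. by rewrite -[br (nl x) v]br_pvl -[br (nl p) v]br_pvl -brDl -mulmxDl addrC subrK. Qed.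

Lemma br_VW x : br (Vp x) (Wp x) = '[Vp x] *: Zp x.
Proof. by rewrite /Wp !brE scaler0 add0r br_Jm ?Zp_pv ?Vp_pv. Qed.

Lemma Yn_pv x : Yn x *m pv = Wp x.
Proof.
by rewrite /Yn 2!mulmxDl -!scalemxAl Zp_pv br_z Wp_pv !scaler0 !addr0.
Qed.

Lemma nl_Yp x : nl (Yp x) = (4 * b)^-1 *: Yn x.
Proof. by rewrite /Yp /nl linearZ /= -/(nl _) nl_mkpt. Qed.

Lemma ht_Yp x : ht (Yp x) = (4 * b)^-1 * Yh x.
Proof. by rewrite /Yp htZ ht_mkpt. Qed.

Lemma zframe_Yp x : zframe x (Yp x) = ((4 * b)^-1 * (2 * ht x)) *: Zp x.
Proof.
rewrite /zframe nl_Yp -scalemxAl brZr pzE Yn_pv br_nl -[br (nl p) _]br_pvr.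
rewrite -[br (Vp x) _]br_pvr Yn_pv br_VW /Yn.
move: (Wp x) (br (nl p) (Wp x)) (Zp x) => W B Z.
by apply/rowP => i; rewrite !mxE; ring.
Qed.

Lemma zframe_nl x u : zframe x u = zframe p u - 2^-1 *: br (Vp x) (nl u).
Proof. by rewrite /zframe br_nl scalerDr opprD addrA. Qed.

(** The frames at p and at x differ by [V, u] / 2. Paired with zeta, this difference becomes <J_zeta
    V, u> / 2, which is the origin of the J term in [Wp]. *)
Lemma gform_Yp x u : half_space p -> half_space x -> gform x (Yp x) u = dQp x u.
Proof.
rewrite /half_space /= => p0 x0; rewrite /gform zframe_Yp nl_Yp ht_Yp -scalemxAl Yn_pv.
rewrite ipZl -ip_pv Wp_pv /Wp ipDl ip_Jm ipZl zframe_nl /dQp /dNq /dbeta /Yh.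
move: (Zp x) (Vp x) (zframe p u) (beta x) (Nq x) => Z V u' B n.
rewrite !ipE [ip h (br _ _) _]ipC.
by field; rewrite !gt_eqF.
Qed.

(** As J_zeta V is orthogonal to V and of norm |zeta| |V|, |W|^2 = (beta^2 + |zeta|^2) |V|^2.
    Substituting |V|^2 = 4 (beta - a - b) leaves a rational identity in a, b, beta and |zeta|^2. *)
Lemma gform_YpYp x : half_space p -> half_space x ->
  gform x (Yp x) (Yp x) = Qp x ^+ 2 - Qp x.
Proof.
rewrite /half_space /= => p0 x0; rewrite /gform zframe_Yp nl_Yp ht_Yp -scalemxAl Yn_pv.
have E : '[Vp x] = 4 * (beta x - ht x - b) by rewrite /beta; field.
have J0 : '[J (Zp x) (Vp x), Vp x] = 0 by exact: ip_Jm_id.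
have JJ : '[J (Zp x) (Vp x)] = '[Zp x] * '[Vp x].
  by rewrite ip_JmJm ?Zp_pv ?Vp_pv.
rewrite /Wp /Qp /Yh /Nq; move: (beta x) (Zp x) (Vp x) E J0 JJ => B Z V.
move: (J Z V) => j E J0 JJ; rewrite !ipE [ip h V j]ipC J0 JJ E.
by field; rewrite !gt_eqF.
Qed.

(** With w = |V|^2 / 4, (a + b + w)^2 - 4 a b = (a - b)^2 + 2 (a + b) w + w^2 is a sum of
    nonnegative terms. The vanishing of each of them gives the equality case, [Qp1]. *)
Lemma Qp_ge1 x : half_space p -> half_space x -> 1 <= Qp x.
Proof.
rewrite /half_space /= => p0 x0; rewrite /Qp ler_pdivlMr ?mulr_gt0// mul1r /Nq.
rewrite -subr_ge0.
have -> : beta x ^+ 2 + '[Zp x] - 4 * ht x * b = (ht x - b) ^+ 2 +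
    ((ht x + b) * '[Vp x] / 2 + (4^-1 * '[Vp x]) ^+ 2) + '[Zp x].
  by rewrite /beta; field.
by rewrite !addr_ge0 ?ip_ge0 ?sqr_ge0 ?mulr_ge0 ?addr_ge0 ?ip_ge0 ?(ltW x0) ?(ltW p0).
Qed.

Lemma Qp1 x : half_space p -> half_space x -> Qp x = 1 -> x = p.
Proof.
rewrite /half_space /= => p0 x0 Q1.
have : (ht x - b) ^+ 2 + (ht x + b) * '[Vp x] / 2 + (4^-1 * '[Vp x]) ^+ 2 +
    '[Zp x] = 0.
  have -> : (ht x - b) ^+ 2 + (ht x + b) * '[Vp x] / 2 +
    (4^-1 * '[Vp x]) ^+ 2 + '[Zp x] = 4 * ht x * b * (Qp x - 1).
    by rewrite /Qp /Nq /beta; field; rewrite !gt_eqF.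
  by rewrite Q1 subrr mulr0.
move/eqP; rewrite paddr_eq0 ?ip_ge0 ?addr_ge0 ?sqr_ge0 ?mulr_ge0 ?addr_ge0 ?ip_ge0
  ?(ltW x0) ?(ltW p0)// => /andP[].
rewrite paddr_eq0 ?ip_ge0 ?addr_ge0 ?sqr_ge0 ?mulr_ge0 ?addr_ge0 ?ip_ge0
  ?(ltW x0) ?(ltW p0)// => /andP[].
rewrite paddr_eq0 ?ip_ge0 ?addr_ge0 ?sqr_ge0 ?mulr_ge0 ?addr_ge0 ?ip_ge0
  ?(ltW x0) ?(ltW p0)// => /andP[].
rewrite sqrf_eq0 subr_eq0 => /eqP hx _.
rewrite sqrf_eq0 mulf_eq0 invr_eq0 pnatr_eq0 /= ip_eq0 => /eqP V0.
rewrite ip_eq0 => /eqP Z0.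
have brp : br (nl p) (nl x) = 0.
  move: V0; rewrite /Vp mulmxBl => /subr0_eq V0.
  by rewrite -br_pvr V0 br_pvr br_alt.
move: Z0; rewrite /Zp brp scaler0 subr0 => Z0.
rewrite -(mkpt_eta x) -(mkpt_eta p) hx; congr mkpt; apply/eqP.
by rewrite -subr_eq0 -[_ - _]mulmx1 -(subrK pv 1%:M) mulmxDr Z0 -/(Vp x) V0 addr0.
Qed.


Lemma Qp_self : half_space p -> Qp p = 1.
Proof.
rewrite /half_space /= => p0; rewrite /Qp /Nq /beta /Zp /Vp subrr !mul0mx !ip0l br_alt.
by rewrite scaler0 subr0 ip0l; field; rewrite gt_eqF.
Qed.

End Base.
End Chart.

(** * Derivatives of Q and of its gradient *)

Section Derivatives.
Context {R : realType} {N : nat} (h : htype R N) (p : 'rV[R]_(1 + N)).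
Local Notation "''[' u , v ]" := (ip h u v).
Local Notation "''[' u ]" := (ip h u u).
Local Notation br := (br h).
Local Notation J := (Jmap h).
Local Notation pv := (pv h).
Local Notation pz := (1%:M - pv).
Local Notation b := (ht p).
Local Notation Vp := (Vp h p).
Local Notation Zp := (Zp h p).
Local Notation beta := (beta h p).
Local Notation Nq := (Nq h p).
Local Notation Qp := (Qp h p).
Local Notation dbeta := (dbeta h p).
Local Notation dNq := (dNq h p).
Local Notation dQp := (dQp h p).
Local Notation Wp := (Wp h p).
Local Notation Yh := (Yh h p).
Local Notation Yn := (Yn h p).
Local Notation Yp := (Yp h p).

Section Along.
Context {V : normedModType R} (c : V -> 'rV[R]_(1 + N)) (t v : V)
  (c' : 'rV[R]_(1 + N)).
Hypothesis Hc : is_derive t v c c'.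

(** The derivatives are taken along an arbitrary map c, which is the identity for partial
    derivatives and a curve for the estimate of lengths. *)
Lemma is_derive_ht : is_derive t v (fun s => ht (c s)) (ht c').
Proof.
have H x : ht x = x 0 (lshift N 0) by rewrite /ht mxE.
rewrite H (_ : (fun s => ht (c s)) = fun s => c s 0 (lshift N 0)).
  exact: is_derive_coord.
by apply/funext => s; rewrite H.
Qed.

Lemma is_derive_nl : is_derive t v (fun s => nl (c s)) (nl c').
Proof.
by apply: (@is_derive_rVlinear _ _ _ _ (@nl R N)) => // a x y; rewrite nlP.
Qed.

Lemma is_derive_Vp : is_derive t v (fun s => Vp (c s)) (nl c' *m pv).
Proof.
rewrite (_ : (fun s => Vp (c s)) =
  (fun s => nl (c s) *m pv) - cst (nl p *m pv)); last first.
  by apply/funext => s; rewrite /Vp mulmxBl.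
apply: (@is_derive_eq _ _ _ _ _ _ _ (nl c' *m pv - 0)); last by rewrite subr0.
apply: is_deriveB.
apply: (@is_derive_rVlinear _ _ _ _ (fun u => u *m pv)); last exact: is_derive_nl.
by move=> a x y; rewrite mulmxDl scalemxAl.
Qed.

Lemma is_derive_Zp : is_derive t v (fun s => Zp (c s)) (zframe h p c').
Proof.
rewrite (_ : (fun s => Zp (c s)) =
  (fun s => zframe h p (c s)) - cst (nl p *m pz)); last first.
  apply/funext => s; rewrite /Zp mulmxBl /zframe -addrA.
  by rewrite [- _ - _]addrC addrA.
apply: (@is_derive_eq _ _ _ _ _ _ _ (zframe h p c' - 0)); last by rewrite subr0.
apply: is_deriveB.
by apply: is_derive_rVlinear => //; exact: zframe_linear.
Qed.

Lemma is_derive_ip (f g : V -> 'rV[R]_N) df dg :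
  is_derive t v f df -> is_derive t v g dg ->
  is_derive t v (fun s => '[f s, g s]) ('[df, g t] + '[f t, dg]).
Proof.
move=> Hf Hg; apply: (@is_derive_bilinear _ _ R) => // u.
  by move=> a x y; rewrite ipDr ipZr.
exact: (ip_scalarl h u).
Qed.

Lemma is_derive_beta : is_derive t v (fun s => beta (c s)) (dbeta (c t) c').
Proof.
have H1 := is_derive_ht.
have H2 := is_derive_ip is_derive_Vp is_derive_Vp.
rewrite /beta; apply: is_derive_eq.
rewrite /dbeta ip_pv Vp_pv -ip_pv Vp_pv [ip h (nl _) _]ipC /GRing.scale /=.
by field.
Qed.

Lemma is_derive_Nq : is_derive t v (fun s => Nq (c s)) (dNq (c t) c').
Proof.
have H1 := is_derive_beta.
have H2 := is_derive_ip is_derive_Zp is_derive_Zp.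
rewrite /Nq; apply: is_derive_eq.
by rewrite /dNq [ip h (zframe _ _ _) _]ipC /GRing.scale /= ?expr1; ring.
Qed.

Lemma is_derive_Qp : 0 < b -> 0 < ht (c t) ->
  is_derive t v (fun s => Qp (c s)) (dQp (c t) c').
Proof.
move=> b0 a0; have H1 := is_derive_Nq; have H2 := is_derive_ht.
have H3 : is_derive t v (fun s => (ht (c s))^-1) (- (ht (c t)) ^- 2 * ht c').
  have [ex2 val2] := H2; have a_neq0 : ht (c t) != 0 by rewrite gt_eqF.
  by apply: DeriveDef; [exact: derivableV|rewrite deriveV// val2].
rewrite (_ : (fun s => Qp (c s)) =
    (fun s => (4 * b)^-1 * (Nq (c s) * (ht (c s))^-1))); last first.
  apply/funext => s; rewrite /Qp -mulrA [ht _ * b]mulrC mulrA invfM.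
  by rewrite mulrC -!mulrA; congr (_ * _); rewrite mulrC.
apply: is_derive_eq; rewrite /dQp /GRing.scale /=.
by field; rewrite !gt_eqF.
Qed.

Definition dWp x u :=
  dbeta x u *: Vp x + beta x *: (nl u *m pv) +
  J (zframe h p u) (Vp x) + J (Zp x) (nl u *m pv).
Definition dYh x u := 2 * ht u * beta x + 2 * ht x * dbeta x u - dNq x u.
Definition dYn x u :=
  dWp x u + ((2 * ht u + '[Vp x, nl u]) *: Zp x +
             (2 * ht x + 2^-1 * '[Vp x]) *: zframe h p u) +
  2^-1 *: br (nl p) (dWp x u).
Definition dYp x u := (4 * b)^-1 *: mkpt (dYh x u) (dYn x u).

Lemma is_derive_scale (k : V -> R) (f : V -> 'rV[R]_N) dk df :
  is_derive t v k dk -> is_derive t v f df ->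
  is_derive t v (fun s => k s *: f s) (dk *: f t + k t *: df).
Proof.
move=> Hk Hf; apply: is_derive_mx => i j.
have Hj := is_derive_coord i j Hf.
rewrite (_ : (fun s => (k s *: f s) i j) = (fun s => k s * f s i j)).
  by apply: is_derive_eq; rewrite !mxE /GRing.scale /=; ring.
by apply/funext => s; rewrite mxE.
Qed.

Lemma is_derive_Wp : is_derive t v (fun s => Wp (c s)) (dWp (c t) c').
Proof.
rewrite /dWp -addrA; apply: is_deriveD.
  exact: is_derive_scale is_derive_beta is_derive_Vp.
apply: is_derive_bilinear; [exact: Jm_linearr|exact: Jm_linearl| |].
  exact: is_derive_Zp.
exact: is_derive_Vp.
Qed.

Lemma is_derive_Yh : is_derive t v (fun s => Yh (c s)) (dYh (c t) c').
Proof.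
have H1 := is_derive_beta; have H2 := is_derive_Nq; have H3 := is_derive_ht.
rewrite /Yh; apply: is_derive_eq.
by rewrite /dYh /GRing.scale /=; ring.
Qed.

Lemma is_derive_Yn : is_derive t v (fun s => Yn (c s)) (dYn (c t) c').
Proof.
have H1 := is_derive_ht; have H2 := is_derive_ip is_derive_Vp is_derive_Vp.
apply: is_deriveD; first apply: is_deriveD.
- exact: is_derive_Wp.
- apply: is_derive_scale is_derive_Zp.
  apply: is_derive_eq.
  rewrite ip_pv Vp_pv -ip_pv Vp_pv [ip h (nl _) _]ipC /GRing.scale /=.
  by field.
- apply: is_deriveZ; apply: is_derive_rVlinear; last exact: is_derive_Wp.
  exact: br_linearr.
Qed.

Lemma is_derive_Yp i j :
  is_derive t v (fun s => Yp (c s) i j) (dYp (c t) c' i j).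
Proof.
apply: is_derive_coord; apply: is_deriveZ; apply: is_derive_mx => k l.
rewrite /mkpt; case: (split_ordP l) => l' ->.
  rewrite row_mxEl ord1 [l']ord1 mxE eqxx mulr1n.
  rewrite (_ : (fun _ => _) = (fun s => Yh (c s))); first exact: is_derive_Yh.
  by apply/funext => s; rewrite row_mxEl mxE eqxx mulr1n.
rewrite row_mxEr (_ : (fun _ => _) = (fun s => Yn (c s) k l')).
  by apply: is_derive_coord; exact: is_derive_Yn.
by apply/funext => s; rewrite row_mxEr.
Qed.

End Along.
End Derivatives.

(** * Divergence of the gradient and volume density *)

Section Divergence.
Context {R : realType} {N : nat} (h : htype R N) (p : 'rV[R]_(1 + N)).
Local Notation "''[' u , v ]" := (ip h u v).
Local Notation "''[' u ]" := (ip h u u).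
Local Notation br := (br h).
Local Notation J := (Jmap h).
Local Notation pv := (pv h).
Local Notation pz := (1%:M - pv).
Local Notation b := (ht p).
Local Notation Vp := (Vp h p).
Local Notation Zp := (Zp h p).
Local Notation beta := (beta h p).
Local Notation Nq := (Nq h p).
Local Notation Qp := (Qp h p).
Local Notation dbeta := (dbeta h p).
Local Notation dNq := (dNq h p).
Local Notation dQp := (dQp h p).
Local Notation Wp := (Wp h p).
Local Notation Yh := (Yh h p).
Local Notation Yn := (Yn h p).
Local Notation Yp := (Yp h p).
Let m : R := (\rank pv)%:R.

Lemma trace_pv : \tr pv = m.
Proof. exact/trace_idempotent/pv_idem. Qed.

Lemma trace_pz : \tr pz = N%:R - m.
Proof. by rewrite linearB /= mxtrace1 trace_pv. Qed.

(** ad_v has its values in the center and vanishes on it, hence has no diagonal part. *)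
Lemma ftrace_br v : ftrace (br v) = 0.
Proof.
rewrite (@eq_ftrace _ _ _ (fun w => br v (w *m pv))); last first.
  by move=> w; rewrite br_pvr.
rewrite (@ftraceC _ _ (br v) (fun w => w *m pv)); last 2 first.
- exact: br_linearr.
- by move=> c u w; rewrite mulmxDl scalemxAl.
by apply: ftrace0 => w; rewrite br_z.
Qed.

Section Trace.
Variable x : 'rV[R]_(1 + N).
Local Notation V := (Vp x).
Local Notation Z := (Zp x).
Local Notation q := (nl p).

Let z w := w *m pz - 2^-1 *: br q w.
Let dW w := (2^-1 * '[V, w]) *: V + beta x *: (w *m pv) + J (z w) V + J Z (w *m pv).

Let z_linear : linear z.
Proof.
move=> c u w; rewrite /z mulmxDl -scalemxAl brDr brZr.
by apply/rowP => i; rewrite !mxE; ring.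
Qed.

Let dW_linear : linear dW.
Proof.
move=> c u w; rewrite /dW z_linear mulmxDl -scalemxAl ipDr ipZr JmDl JmDr JmZl JmZr.
move: (J _ _) (J _ _) (J _ _) (J _ _) (beta x) => j1 j2 j3 j4 B.
move: V (u *m pv) (w *m pv) => v0 u' w'.
by apply/rowP => i; rewrite !mxE; ring.
Qed.

Let ftrace_z : ftrace z = N%:R - m.
Proof.
rewrite /z (ftraceD (fun w => w *m pz) (fun w => - (2^-1 *: br q w))).
rewrite ftrace_mulmx trace_pz (@eq_ftrace _ _ _ (fun w => (- 2^-1) *: br q w)).
  by rewrite ftraceZ ftrace_br mulr0 addr0.
by move=> w; rewrite scaleNr.
Qed.

(** This trace depends on [nl p] and need not vanish. It enters the trace of [dW] with coefficient
    -1/2 and that of the bracket term of [dYn] with 1/2, so its value never matters. *)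
Let T := ftrace (fun w => J (br q w) V).

Let ftrace_dW : ftrace dW = 2^-1 * '[V] + beta x * m - 2^-1 * T.
Proof.
rewrite /dW (ftraceD (fun w => _ + _ + _) (fun w => J Z (w *m pv))).
rewrite (ftraceD (fun w => _ + _) (fun w => J (z w) V)).
rewrite (ftraceD (fun w => _ *: V) (fun w => beta x *: (w *m pv))).
rewrite (ftrace_rank1 (l := fun w => 2^-1 * '[V, w])); last first.
  by move=> c u w; rewrite ipDr ipZr; ring.
rewrite ftraceZ ftrace_mulmx trace_pv.
have -> : ftrace (fun w => J Z (w *m pv)) = 0.
  rewrite (@ftraceC _ _ (J Z) (fun w => w *m pv)); last 2 first.
  - exact: Jm_linearr.
  - by move=> c u w; rewrite mulmxDl scalemxAl.
  rewrite (@eq_ftrace _ _ _ (J Z)); first exact: ftrace_Jm.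
  by move=> w; rewrite Jm_pv.
rewrite addr0; congr (_ + _).
(* The map sending w to J_y V, with y the central part of w, kills v and has its values in v: its
   trace is 0. *)
rewrite (@eq_ftrace _ _ _ (fun w => J (w *m pz) V + (- 2^-1) *: J (br q w) V)).
  rewrite (ftraceD (fun w => J (w *m pz) V)) ftraceZ mulNr -/T.
  rewrite (@ftraceC _ _ (J^~ V) (fun w => w *m pz)); last 2 first.
  - exact: Jm_linearl.
  - by move=> c u w; rewrite mulmxDl scalemxAl.
  rewrite ftrace0 ?add0r// => w.
  by rewrite pzE Jm_pv subrr.
by move=> w; rewrite /z JmDl JmNl JmZl scaleNr.
Qed.

Let ftrace_br_dW : ftrace (fun w => br q (dW w)) = T.
Proof.
(* By cyclicity [dW] is applied to [q, w] instead. This is central, so only the term of [dW] with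
   [J (z _) V] survives. *)
rewrite ftraceC; [|exact: br_linearr|exact: dW_linear].
apply: eq_ftrace => w; have u0 := br_z h q w.
rewrite /dW /z pzE -[br q (br q w)]br_pvr u0 br0r (ip_vz (Vp_pv h p x) u0).
by rewrite mulr0 scale0r !scaler0 !subr0 Jm0r !add0r addr0.
Qed.

(** The divergence in the chart, without the volume density. Since 2 a + |V|^2 / 2 = 2 beta - 2 b,
    the height and the center contribute 1 + dim z copies of this quantity, and v contributes beta
    dim v. *)
Lemma divergence_Yp : \sum_i dYp h p x 'e_i 0 i =
  (4 * b)^-1 * (beta x * (2 + 2 * N%:R - m) - 2 * b * (1 + N%:R - m)).
Proof.
have zt0 : zframe h p (mkpt 1 0) = 0 by rewrite /zframe nl_mkpt mul0mx br0r scaler0 subr0.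
have ztE w : zframe h p (mkpt 0 w) = z w by rewrite /zframe nl_mkpt.
rewrite big_split_ord /= big_ord1.
have -> : ('e_(lshift N 0) : 'rV[R]_(1 + N)) = mkpt 1 0.
  rewrite delta_mx_lshift /mkpt; congr row_mx.
  by apply/matrixP => i j; rewrite !ord1 !mxE !eqxx.
have -> : dYp h p x (mkpt 1 0) 0 (lshift N 0) = (4 * b)^-1 * (2 * ht x).
  rewrite /dYp /mkpt mxE row_mxEl mxE eqxx mulr1n -/(mkpt 1 0); congr (_ * _).
  by rewrite /dYh /dNq /dbeta zt0 nl_mkpt ht_mkpt !ip0r; ring.
rewrite (eq_bigr (fun i => (4 * b)^-1 * (dYn h p x (mkpt 0 'e_i) 0 i))); last first.
  move=> i _; have -> : ('e_(rshift 1 i) : 'rV[R]_(1 + N)) = mkpt 0 'e_i.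
    by rewrite delta_mx_rshift /mkpt raddf0.
  by rewrite /dYp /mkpt mxE row_mxEr.
rewrite -mulr_sumr -/(ftrace (fun w => dYn h p x (mkpt 0 w))) -mulrDr; congr (_ * _).
pose c := 2 * ht x + 2^-1 * '[V].
rewrite (@eq_ftrace _ _ _
  (fun w => dW w + ('[V, w] *: Z + c *: z w) + 2^-1 *: br q (dW w))); last first.
  move=> w; have dWE : dWp h p x (mkpt 0 w) = dW w.
    by rewrite /dWp /dbeta ht_mkpt nl_mkpt add0r ztE.
  by rewrite /dYn dWE ht_mkpt nl_mkpt ztE mulr0 add0r.
rewrite (ftraceD (fun w => _ + _)) (ftraceD dW) ftraceZ ftrace_br_dW ftrace_dW.
rewrite (ftraceD (fun w => _ *: Z)) ftraceZ ftrace_z (ftrace_rank1 (l := ip h V));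
  last by move=> k u w; rewrite ipDr ipZr.
rewrite (ip_vz (Vp_pv h p x) (Zp_pv h p x)) /c /beta.
by field.
Qed.

End Trace.

(** * The Riemannian volume density *)

Section Volume.
Variable G : 'rV[R]_(1 + N) -> 'M[R]_(1 + N).
Hypothesis GE : forall x, half_space x -> forall u w,
  (u *m G x *m w^T) 0 0 = gform h x u w.

(** [S0] is the Gram matrix of the inner product on the Lie algebra of S; [Lx x] below is the matrix
    of the differential that carries tangent vectors at x to that Lie algebra. *)
Let S0 : 'M[R]_(1 + N) := block_mx 1%:M 0 0 (gram (ip h)).

Let Lx x : 'M[R]_(1 + N) := block_mx (ht x)^-1%:M 0 0
  (Num.sqrt (ht x)^-1 *: pv + (ht x)^-1 *: (pz - 2^-1 *: lin1_mx (br (nl x)))).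

Lemma gram_ip (u w : 'rV[R]_N) : (u *m gram (ip h) *m w^T) 0 0 = '[u, w].
Proof.
by apply: gramE => v; [move=> c x y; rewrite ipDr ipZr|exact: ip_scalarl].
Qed.

Lemma metric_factor x : half_space x -> G x = Lx x *m S0 *m (Lx x)^T.
Proof.
move=> Ux; apply: mx_eq_forms => u w; rewrite GE//.
rewrite -[u]mkpt_eta -[w]mkpt_eta; move: (ht u) (nl u) (ht w) (nl w) => a v c y.
have LE k y' : mkpt k y' *m Lx x = mkpt (k * (ht x)^-1)
   (Num.sqrt (ht x)^-1 *: (y' *m pv) + (ht x)^-1 *: zframe h x (mkpt k y')).
  rewrite /mkpt mul_row_block !mulmx0 addr0 add0r; congr row_mx.
    by rewrite -scalar_mxM.
  rewrite mulmxDr -!scalemxAr mulmxBr -scalemxAr lin1_mxP; last exact: br_linearr.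
  by rewrite -/(mkpt k y') /zframe nl_mkpt.
rewrite -[RHS]/((_ *m _ *m _) 0 0) !mulmxA -mulmxA -trmx_mul !LE.
rewrite /S0 {1 2}/mkpt mul_row_block !mulmx0 addr0 add0r mulmx1.
rewrite tr_row_mx mul_row_col tr_scalar_mx -scalar_mxM mxE [X in _ + X]gram_ip.
rewrite mxE eqxx mulr1n /gform !nl_mkpt !ht_mkpt.
have ztv w' : zframe h x w' *m pv = 0 by rewrite /zframe mulmxBl pz_pv -scalemxAl br_z scaler0 subr0.
have vv (y' : 'rV[R]_N) : y' *m pv *m pv = y' *m pv by rewrite -mulmxA pv_idem.
move: (ztv (mkpt a v)) (ztv (mkpt c y)) (vv v) (vv y).
move: (zframe h x (mkpt a v)) (zframe h x (mkpt c y)) (v *m pv) (y *m pv) => z1 z2 v1 v2.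
move=> z10 z20 v10 v20; rewrite !ipE (ip_vz v10 z20) [ip h z1 v2]ipC (ip_vz v20 z10).
have {1}-> : (ht x)^-1 = Num.sqrt (ht x)^-1 ^+ 2.
  by rewrite sqr_sqrtr ?invr_ge0 ?(ltW Ux).
by ring.
Qed.

Let r := \rank pv.

(** In powers of a^(-1/2), the height counts 2, each of the r dimensions of v counts 1 and each of
    the N - r central dimensions counts 2. Integral powers of a square root replace real powers of
    a. *)
Lemma det_Lx x : half_space x ->
  \det (Lx x) = (Num.sqrt (ht x))^-1 ^+ (2 + 2 * N - r).
Proof.
rewrite /half_space /= => x0; rewrite /Lx det_ublock.
set s := Num.sqrt (ht x)^-1.
have s0 : 0 < s by rewrite sqrtr_gt0 invr_gt0.
have sE : s = (Num.sqrt (ht x))^-1 by rewrite /s sqrtrV// ltW.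
have tE : (ht x)^-1 = s ^+ 2 by rewrite sqr_sqrtr// invr_ge0 ltW.
rewrite tE -sE; move BD : (lin1_mx _) => B.
have BE u : u *m B = br (nl x) u by rewrite -BD; apply: lin1_mxP; exact: br_linearr.
have pvB : pv *m B = B.
  by apply/row_matrixP => i; rewrite !rowE mulmxA BE br_pvr -BE.
have Bpv : B *m pv = 0.
  by apply/row_matrixP => i; rewrite !rowE mulmxA BE br_z mulmx0.
(* Scaling times shear. The shear has determinant 1 because B has its values in the center, that is
   B pv = 0. *)
have -> : s *: pv + s ^+ 2 *: (pz - 2^-1 *: B) =
    (s ^+ 2 *: (1%:M + (s^-1 - 1) *: pv)) *m (1%:M + pv *m (- (s / 2) *: B)).
  rewrite -scalemxAl mulmxDl !mul1mx -scalemxAl mulmxDr mulmx1.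
  rewrite -!scalemxAr !pvB.
  apply/matrixP => i j; rewrite !mxE; field.
  by rewrite gt_eqF.
rewrite det_mulmx detZ det_1idempotent ?pv_idem// det_1mulmx -scalemxAl Bpv scaler0.
rewrite addr0 det1 mulr1 [1 + _]addrC subrK det_scalar1.
have rN : (r <= 2 + 2 * N)%N.
  by rewrite (leq_trans (rank_leq_row _))// mul2n -addnn addnA leq_addl.
rewrite -exprM mulrA -exprD exprVn -{1}(subnK rN) exprD mulfK//.
by rewrite expf_neq0 ?gt_eqF.
Qed.

(** Twice kappa. The subtraction of natural numbers does not truncate, as r <= N. *)
Definition volexp : nat := (2 + 2 * N - r)%N.

(** The constant is the volume of the standard basis at the identity; it cancels from the Laplacian
    and is left unevaluated. *)
Lemma volE : exists C, forall x : 'rV[R]_(1 + N), half_space x ->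
  Num.sqrt (\det (G x)) = C * (Num.sqrt (ht x))^-1 ^+ volexp.
Proof.
exists (Num.sqrt (\det S0)) => x Ux.
rewrite metric_factor// !det_mulmx det_tr det_Lx//.
rewrite mulrC mulrA -expr2 sqrtrM ?sqr_ge0// sqrtr_sqr mulrC.
by rewrite ger0_norm// exprn_ge0// invr_ge0 sqrtr_ge0.
Qed.

Lemma is_derive_vol (x u : 'rV[R]_(1 + N)) : half_space x ->
  is_derive x u (fun y => (Num.sqrt (ht y))^-1 ^+ volexp)
    (- (volexp%:R / 2) * (Num.sqrt (ht x))^-1 ^+ volexp * (ht x)^-1 * ht u).
Proof.
move=> Ux; have s0 : 0 < Num.sqrt (ht x) by rewrite sqrtr_gt0.
have H1 : is_derive x u (fun y => Num.sqrt (ht y)) ((2 * Num.sqrt (ht x))^-1 * ht u).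
  apply: is_derive_chain; first exact: is_derive1_sqrt.
  exact: (is_derive_ht (is_derive_id x u)).
have H2 : is_derive x u (fun y => (Num.sqrt (ht y))^-1)
    (- (Num.sqrt (ht x)) ^- 2 * ((2 * Num.sqrt (ht x))^-1 * ht u)).
  have [ex1 val1] := H1; have sn0 : Num.sqrt (ht x) != 0 by rewrite gt_eqF.
  by apply: DeriveDef; [exact: derivableV|rewrite deriveV// val1].
have H3 : is_derive (Num.sqrt (ht x))^-1 1 (@GRing.exp R ^~ volexp)
    (volexp%:R * (Num.sqrt (ht x))^-1 ^+ volexp.-1).
  apply: DeriveDef; first exact: exprn_derivable.
  by rewrite exp_derive /GRing.scale /= mulr1.
apply: (is_derive_eq (is_derive_chain (g := fun y : 'rV[R]_(1 + N) =>
  (Num.sqrt (ht y))^-1) H3 H2)).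
have -> : (ht x)^-1 = (Num.sqrt (ht x))^-1 ^+ 2.
  by rewrite exprVn sqr_sqrtr// ltW.
case: volexp => [|n]; first by rewrite !mul0r oppr0 !mul0r.
rewrite [_ ^+ n.+1]exprS /=.
by field; rewrite gt_eqF.
Qed.

End Volume.
End Divergence.

(** * The Laplacian of a radial function *)

Section Laplacian.
Context {R : realType} {N : nat} (h : htype R N) (p : 'rV[R]_(1 + N)).
Local Notation "''[' u , v ]" := (ip h u v).
Local Notation "''[' u ]" := (ip h u u).
Local Notation br := (br h).
Local Notation J := (Jmap h).
Local Notation pv := (pv h).
Local Notation pz := (1%:M - pv).
Local Notation b := (ht p).
Local Notation Vp := (Vp h p).
Local Notation Zp := (Zp h p).
Local Notation beta := (beta h p).
Local Notation Nq := (Nq h p).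
Local Notation Qp := (Qp h p).
Local Notation dbeta := (dbeta h p).
Local Notation dNq := (dNq h p).
Local Notation dQp := (dQp h p).
Local Notation Wp := (Wp h p).
Local Notation Yh := (Yh h p).
Local Notation Yn := (Yn h p).
Local Notation Yp := (Yp h p).
Variable G : 'rV[R]_(1 + N) -> 'M[R]_(1 + N).
Hypothesis GE : forall x, half_space x -> forall u w,
  (u *m G x *m w^T) 0 0 = gform h x u w.
Hypothesis p0 : half_space p.

Let kappa : R := (volexp h)%:R / 2.

Lemma kappaE : kappa = 1 + N%:R - (\rank pv)%:R / 2.
Proof.
rewrite /kappa /volexp natrB; last first.
  by rewrite (leq_trans (rank_leq_row _))// mul2n -addnn addnA leq_addl.
by rewrite natrD natrM; field.
Qed.

Lemma metric_unitmx x : half_space x -> G x \in unitmx.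
Proof.
by move=> Ux; apply: posdef_unitmx => u u0; rewrite GE//; exact: gform_gt0.
Qed.

(** By [gform_Yp] the matrix G sends [Yp] to the differential of Q; inverting G gives the cometric
    form used in [laplace_beltrami]. *)
Lemma metric_grad x : half_space x ->
  forall i, \sum_j invmx (G x) i j * dQp x 'e_j = Yp x 0 i.
Proof.
move=> Ux i; have -> : Yp x 0 i = (invmx (G x) *m (G x *m (Yp x)^T)) i 0.
  by rewrite mulKmx ?metric_unitmx// [RHS]mxE.
rewrite mxE; apply: eq_bigr => j _; congr (_ * _).
rewrite -gform_Yp// gformC -GE// -mulmxA -rowE.
by rewrite [LHS]mxE.
Qed.

Lemma sum_delta (l : 'rV[R]_(1 + N) -> R) (y : 'rV[R]_(1 + N)) : scalar l ->
  \sum_i l 'e_i * y 0 i = l y.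
Proof.
move=> ll; rewrite -(ftrace_rank1 _ ll).
by apply: eq_bigr => i _; rewrite mxE.
Qed.

Lemma Qp_gt1 x : half_space x -> x != p -> 1 < Qp x.
Proof.
move=> Ux xp; rewrite lt_neqAle Qp_ge1// andbT eq_sym.
by apply: contraNneq xp => /Qp1 ->.
Qed.

Let U' := half_space `&` ~` [set p].

Let nearU' x : half_space x -> x != p -> \near x, half_space x /\ x != p.
Proof.
move=> Ux xp; have oU' : open U'.
  apply: openI; first exact: open_half_space.
  by apply: closed_openC; exact: accessible_closed_set1 (hausdorff_accessible (@norm_hausdorff _ _)) _.
have : nbhs x U' by apply: open_nbhs_nbhs; split=> //; split=> //; exact/eqP.
by apply: filterS => y [Uy yp]; split=> //; exact/eqP.
Qed.

Variables (f : 'rV[R]_(1 + N) -> R) (F F1 F2 : R -> R).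
Hypothesis fE : forall y, half_space y -> y != p -> f y = F (Qp y).
Hypothesis dF : forall q : R, 1 < q -> is_derive q (1 : R) F (F1 q).
Hypothesis dF1 : forall q : R, 1 < q -> is_derive q (1 : R) F1 (F2 q).

Let partial_f x j : half_space x -> x != p -> partial j f x = F1 (Qp x) * dQp x 'e_j.
Proof.
move=> Ux xp; rewrite /partial (near_eq_derive (g := fun y => F (Qp y))); last first.
  by apply: filterS (nearU' Ux xp) => y [Uy yp]; exact: fE.
have := is_derive_chain (g := Qp) (dF (Qp_gt1 Ux xp))
  (is_derive_Qp h (is_derive_id x ('e_j : 'rV[R]_(1 + N))) p0 Ux).
by case.
Qed.

(** Product rule for vol F1(Q) grad Q: F2 multiplies |grad Q|^2, while F1 multiplies div(grad Q) -
    (kappa / a) ht(grad Q). In the latter, the coefficient 2 + 2 N - dim v of beta in the divergence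
    equals 2 kappa, so beta cancels and kappa Q - (1 + dim z) / 2 remains. *)
Lemma laplace_radial : exists C, forall x, half_space x -> x != p ->
  laplace_beltrami G f x = C * (F2 (Qp x) * (Qp x ^+ 2 - Qp x) +
    F1 (Qp x) * (kappa * Qp x - (1 + N%:R - (\rank pv)%:R) / 2)).
Proof.
have [c volc] := volE GE.
(* This is 1 when c is nonzero; left in this form it also covers c = 0, where the inverse is 0 by
   default and both sides vanish. *)
exists (c^-1 * c) => x Ux xp; rewrite /laplace_beltrami volc//.
pose s (y : 'rV[R]_(1 + N)) : R := (Num.sqrt (ht y))^-1 ^+ volexp h.
have s0 : s x != 0.
  by rewrite expf_neq0// invr_neq0// gt_eqF// sqrtr_gt0.
have dE i : partial i (fun y => Num.sqrt (\det (G y)) *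
    \sum_j invmx (G y) i j * partial j f y) x =
    c * s x * (F1 (Qp x) * (dYp h p x 'e_i 0 i - kappa / ht x * (ht ('e_i : 'rV[R]_(1 + N)) * Yp x 0 i)) +
      F2 (Qp x) * (dQp x 'e_i * Yp x 0 i)).
  rewrite /partial (near_eq_derive (g := fun y => c * (s y * (F1 (Qp y) * Yp y 0 i))));
    last first.
    apply: filterS (nearU' Ux xp) => y [Uy yp].
    rewrite volc// -/(s y) -mulrA; congr (_ * (_ * _)).
    rewrite -metric_grad// mulr_sumr; apply: eq_bigr => j _.
    by rewrite -/(partial j f y) partial_f// mulrCA.
  have D1 := is_derive_vol h ('e_i : 'rV[R]_(1 + N)) Ux.
  have D2 := is_derive_chain (g := Qp) (dF1 (Qp_gt1 Ux xp))
    (is_derive_Qp h (is_derive_id x ('e_i : 'rV[R]_(1 + N))) p0 Ux).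
  have D3 := is_derive_Yp h p (is_derive_id x ('e_i : 'rV[R]_(1 + N))) 0 i.
  have -> : (fun y => c * (s y * (F1 (Qp y) * Yp y 0 i))) =
    c \*: ((s : 'rV[R]_(1 + N) -> R) * ((fun y => F1 (Qp y)) * (fun y => Yp y 0 i))).
    by [].
  have [_ ->] := is_deriveZ c (is_deriveM D1 (is_deriveM D2 D3)).
  rewrite /GRing.scale /= -/(s x) -/kappa.
  have -> : ((fun y => F1 (Qp y)) * (fun y => Yp y 0 i)) x = F1 (Qp x) * Yp x 0 i by [].
  by ring.
rewrite (eq_bigr _ (fun i _ => dE i)) -mulr_sumr big_split /= -!mulr_sumr.
rewrite big_split /= sumrN -mulr_sumr divergence_Yp.
rewrite (sum_delta (l := @ht R N)); last by move=> k u w; rewrite htP.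
rewrite (sum_delta (l := dQp x)); last first.
  by move=> k u w; rewrite -!gform_Yp//; exact: gform_scalarr.
rewrite -gform_Yp// gform_YpYp// ht_Yp kappaE invfM.
have [-> |c0] := eqVneq c 0; first by rewrite invr0 !mul0r.
have b0 := p0; have x0 := Ux; rewrite /half_space /= in b0 x0.
rewrite -/(s x) /Qp /Yh; field.
by rewrite c0 s0 !gt_eqF.
Qed.

End Laplacian.

(** * Radial functions as functions of Q *)

Section Profile.
Context {R : realType} {N : nat} (h : htype R N) (p : 'rV[R]_(1 + N)).
Local Notation "''[' u , v ]" := (ip h u v).
Local Notation "''[' u ]" := (ip h u u).
Local Notation br := (br h).
Local Notation J := (Jmap h).
Local Notation pv := (pv h).
Local Notation pz := (1%:M - pv).
Local Notation b := (ht p).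
Local Notation Vp := (Vp h p).
Local Notation Zp := (Zp h p).
Local Notation beta := (beta h p).
Local Notation Nq := (Nq h p).
Local Notation Qp := (Qp h p).
Local Notation dbeta := (dbeta h p).
Local Notation dNq := (dNq h p).
Local Notation dQp := (dQp h p).
Local Notation Wp := (Wp h p).
Local Notation Yh := (Yh h p).
Local Notation Yn := (Yn h p).
Local Notation Yp := (Yp h p).
Hypothesis p0 : half_space p.

(* [exp_dist (Qp x)] is the exponential of the distance from x to p. *)
Definition exp_dist (q : R) : R := 2 * q - 1 + 2 * Num.sqrt (q ^+ 2 - q).

Lemma exp_dist_ge1 q : 1 <= q -> 1 <= exp_dist q.
Proof.
by move=> q1; have := sqrtr_ge0 (q ^+ 2 - q); rewrite /exp_dist; lra.
Qed.

(** With s = e^d, cosh^2(d / 2) = (s + 1)^2 / (4 s); [exp_dist q] is the root s >= 1 of (s + 1)^2 =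
    4 q s. *)
Lemma exp_distK q : 1 <= q -> (exp_dist q + 1) ^+ 2 / (4 * exp_dist q) = q.
Proof.
move=> q1; have s1 := exp_dist_ge1 q1.
have q2 : 0 <= q ^+ 2 - q by nra.
have E : (exp_dist q + 1) ^+ 2 = 4 * exp_dist q * q.
  have := sqr_sqrtr q2; rewrite /exp_dist; set t := Num.sqrt _ => tE.
  have -> : (2 * q - 1 + 2 * t + 1) ^+ 2 = 4 * q ^+ 2 + 8 * q * t + 4 * t ^+ 2 by ring.
  by rewrite tE; ring.
by rewrite E mulrAC mulfV ?mul1r// mulf_neq0// gt_eqF//; lra.
Qed.

Lemma exp_dist_inj q q' : 1 <= q -> 1 <= q' -> exp_dist q = exp_dist q' -> q = q'.
Proof. by move=> q1 q1' E; rewrite -(exp_distK q1) -(exp_distK q1') E. Qed.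

(** On the vertical ray p A both V and zeta vanish. The ray meets every level set of Q, so it can
    serve to read off the profile of a radial function. *)
Lemma Qp_ray s : 0 < s -> Qp (mkpt (b * s) (nl p)) = (s + 1) ^+ 2 / (4 * s).
Proof.
move=> s0; have b0 : 0 < b := p0.
rewrite /Qp /Nq /beta /Zp /Vp ht_mkpt nl_mkpt subrr !mul0mx br_alt.
by rewrite scaler0 subr0 !ip0l; field; rewrite !gt_eqF.
Qed.

Let dsg (q : R) : R := 2 + (2 * q - 1) / Num.sqrt (q ^+ 2 - q).

Let rad_gt0 (q : R) : 1 < q -> 0 < q ^+ 2 - q.
Proof. by move=> q1; nra. Qed.

Let is_derive_rad (q : R) : is_derive q (1 : R) (fun q : R => q ^+ 2 - q) (2 * q - 1).
Proof.
rewrite (_ : (fun q : R => q ^+ 2 - q) = (id * id) - id).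
  by apply: is_derive_eq; rewrite /GRing.scale /= !mulr1; ring.
by apply/funext => y /=; rewrite expr2.
Qed.

Let is_derive_sqrt_rad (q : R) : 1 < q -> is_derive q (1 : R)
  (fun q : R => Num.sqrt (q ^+ 2 - q))
  ((2 * Num.sqrt (q ^+ 2 - q))^-1 * (2 * q - 1)).
Proof.
move=> q1.
apply: (is_derive_chain (g := fun q : R => q ^+ 2 - q) _ (is_derive_rad q)).
by apply: is_derive1_sqrt; exact: rad_gt0.
Qed.

Let is_derive_sg (q : R) : 1 < q -> is_derive q (1 : R) exp_dist (dsg q).
Proof.
move=> q1; have H := is_derive_sqrt_rad q1.
rewrite (_ : exp_dist = (2 \*: id) - cst 1 + (2 \*: (fun q : R => Num.sqrt (q ^+ 2 - q)))).
  apply: is_derive_eq; rewrite /dsg /GRing.scale /=.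
  by field; rewrite gt_eqF// sqrtr_gt0 rad_gt0.
by apply/funext.
Qed.

Let derivable_dsg (q : R) : 1 < q -> derivable dsg q (1 : R).
Proof.
move=> q1; have [H _] := is_derive_sqrt_rad q1.
have Hi : derivable (fun q : R => (Num.sqrt (q ^+ 2 - q))^-1) q (1 : R).
  by apply: derivableV => //; rewrite gt_eqF// sqrtr_gt0 rad_gt0.
rewrite (_ : dsg = cst 2 + ((2 \*: id) - cst 1) *
    (fun q : R => (Num.sqrt (q ^+ 2 - q))^-1)); last by apply/funext.
apply: derivableD; first exact: derivable_cst.
by apply: derivableM => //; exact: derivableB.
Qed.

Let e0 : 'rV[R]_(1 + N) := 'e_(lshift N 0).

Let is_derive_ray (f : 'rV[R]_(1 + N) -> R) t v :
  derivable f (mkpt t v) e0 ->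
  is_derive t (1 : R) (fun t => f (mkpt t v)) ('D_e0 f (mkpt t v)).
Proof.
move=> /derivableP /is_derive_line H; apply/is_derive_line.
rewrite (_ : (fun k : R => f (mkpt (k *: (1 : R) + t) v)) =
  (fun k => f (k *: e0 + mkpt t v)))//.
apply/funext => k; congr f; rewrite /e0 delta_mx_lshift.
have -> : row_mx (delta_mx 0 0) 0 = mkpt 1 0 :> 'rV[R]_(1 + N).
  by rewrite /mkpt; congr row_mx; apply/matrixP => i j; rewrite !ord1 !mxE !eqxx.
by rewrite -mkptP scaler0 add0r.
Qed.

(** F is f read along the vertical ray at height b e^d. Passing from q to d involves the square root
    of q^2 - q, not differentiable at q = 1, hence the restriction to q > 1. *)
Lemma radial_profile (f : 'rV[R]_(1 + N) -> R) : Ck 2 half_space f ->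
  (forall x y, half_space x -> half_space y -> Qp x = Qp y -> f x = f y) ->
  exists F F1 F2 : R -> R,
    [/\ forall y, half_space y -> f y = F (Qp y),
        forall q : R, 1 < q -> is_derive q (1 : R) F (F1 q) &
        forall q : R, 1 < q -> is_derive q (1 : R) F1 (F2 q)].
Proof.
move=> [_ /(_ (lshift N 0))[df [_ /(_ (lshift N 0))[d2f _]]]] fQ.
have b0 : 0 < b := p0.
have ray q : 1 <= q -> half_space (mkpt (b * exp_dist q) (nl p)).
  by move=> /exp_dist_ge1 s1; rewrite /half_space /= ht_mkpt mulr_gt0//; lra.
have bsg (q : R) : 1 < q -> is_derive q (1 : R) (fun q => b * exp_dist q) (b * dsg q).
  by move=> q1; have H := is_derive_sg q1; apply: (is_deriveZ b H).
pose F1 q := partial (lshift N 0) f (mkpt (b * exp_dist q) (nl p)) * (b * dsg q).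
(* For the second derivative existence is enough: its value never enters, so F2 is taken to be the
   derivative of F1. *)
exists (fun q => f (mkpt (b * exp_dist q) (nl p))), F1, (fun q => 'D_1 F1 q); split.
- move=> y Uy; have Q1 := Qp_ge1 h p0 Uy.
  apply: fQ => //; first exact: ray.
  by rewrite Qp_ray ?exp_distK//; have := exp_dist_ge1 Q1; lra.
- move=> q q1; apply: (is_derive_chain (f := fun t => f (mkpt t (nl p)))
    (g := fun q => b * exp_dist q) _ (bsg _ q1)).
  by apply: is_derive_ray; apply: df; apply: ray; exact: ltW.
- move=> q q1; apply: derivableP; apply: derivableM; last first.
    by apply: derivableZ; exact: derivable_dsg.
  have := is_derive_chain (f := fun t => partial (lshift N 0) f (mkpt t (nl p)))
    (g := fun q => b * exp_dist q)
    (is_derive_ray (d2f _ (ray _ (ltW q1)))) (bsg _ q1).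
  by case.
Qed.

End Profile.

(** * The geodesic distance *)

Section PathLength.
Context {R : realType}.

Lemma continuous_sum (T : topologicalType) n (F : 'I_n -> T -> R) x :
  (forall i, {for x, continuous (F i)}) ->
  {for x, continuous (fun y => \sum_i F i y)}.
Proof.
move=> cF; rewrite (_ : (fun y => _) = \sum_i F i); last first.
  by apply/funext => y; rewrite fct_sumE.
elim/big_ind : _ => //; first exact: cst_continuous.
by move=> f g cf cg; apply: cvgD.
Qed.

Notation mu := (@lebesgue_measure R).

(** The mean value theorem for P - g, with P the primitive of s vanishing at 0; in this way dg
    itself is never integrated. *)
Lemma increment_le_Rintegral (g dg s : R -> R) :
  (forall t : R, 0 <= t <= 1 -> {for t, continuous s}) ->
  (forall t : R, 0 <= t <= 1 -> is_derive t (1 : R) g (dg t)) ->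
  (forall t : R, 0 <= t <= 1 -> dg t <= s t) ->
  g 1 - g 0 <= \int[mu]_(t in `[0, 1]) s t.
Proof.
move=> cs dgt gs.
have ws : {within `[0, 1], continuous s}.
  apply: continuous_in_subspaceT => t; rewrite inE /= in_itv /=; exact: cs.
have ints : mu.-integrable `[0, 1] (EFin \o s).
  by apply: continuous_compact_integrable => //; exact: segment_compact.
pose P x := parameterized_integral mu 0 x s.
have Pc : {within `[0, 1], continuous P}.
  by apply: parameterized_integral_continuous.
have dP (t : R) : t \in `]0, 1[ -> is_derive t (1 : R) P (s t).
  rewrite in_itv /= => /andP[t0 t1].
  have [] := @continuous_FTC1_closed R s 0 t 1 t1 ints t0.
    by apply: cs; rewrite !ltW.
  by move=> ex <-; apply: DeriveDef => //; rewrite derive1E.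
have gc : {within `[0, 1], continuous g}.
  apply: continuous_in_subspaceT => t; rewrite inE /= in_itv /= => t01.
  apply/differentiable_continuous/derivable1_diffP.
  by have [] := dgt t t01.
have dH (t : R) : t \in `]0, 1[ -> is_derive t (1 : R) (P - g) (s t - dg t).
  move=> tt; have := dP t tt; move: tt; rewrite in_itv /= => /andP[t0 t1] HP.
  by have Hg := dgt t; apply: is_deriveB; apply: Hg; rewrite !ltW.
have Hc : {within `[0, 1], continuous (P - g)}.
  by move=> t; apply: cvgB; [exact: Pc|exact: gc].
have [t /andP[]] := MVT ltr01 dH Hc.
rewrite /= !bnd_simp => t0 t1.
rewrite subr0 mulr1 => E.
have P0 : P 0 = 0 by rewrite /P /parameterized_integral set_itv1 Rintegral_set1.
have : 0 <= s t - dg t by rewrite subr_ge0 gs// !ltW.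
rewrite -E -[(P - g) 1]/(P 1 - g 1) -[(P - g) 0]/(P 0 - g 0) P0.
rewrite -[\int[_]_(_ in _) _]/(P 1); lra.
Qed.

Lemma abs_increment_le_Rintegral (g dg s : R -> R) :
  (forall t : R, 0 <= t <= 1 -> {for t, continuous s}) ->
  (forall t : R, 0 <= t <= 1 -> is_derive t (1 : R) g (dg t)) ->
  (forall t : R, 0 <= t <= 1 -> `|dg t| <= s t) ->
  `|g 1 - g 0| <= \int[mu]_(t in `[0, 1]) s t.
Proof.
move=> cs dgt gs; rewrite ler_norml; apply/andP; split.
  rewrite lerNl opprB addrC -[g 0]opprK.
  apply: (@increment_le_Rintegral (- g) (- dg)) => // t t01.
    by have H := dgt t t01; apply: is_deriveN.
  by rewrite (le_trans _ (gs t t01))// -normrN ler_norm.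
apply: (@increment_le_Rintegral g dg) => // t t01.
by rewrite (le_trans (ler_norm _))// gs.
Qed.

End PathLength.

(** * Lower bound for the length of curves *)

Section LowerBound.
Context {R : realType} {N : nat} (h : htype R N) (p : 'rV[R]_(1 + N)).
Local Notation "''[' u , v ]" := (ip h u v).
Local Notation "''[' u ]" := (ip h u u).
Local Notation br := (br h).
Local Notation J := (Jmap h).
Local Notation pv := (pv h).
Local Notation pz := (1%:M - pv).
Local Notation b := (ht p).
Local Notation Vp := (Vp h p).
Local Notation Zp := (Zp h p).
Local Notation beta := (beta h p).
Local Notation Nq := (Nq h p).
Local Notation Qp := (Qp h p).
Local Notation dbeta := (dbeta h p).
Local Notation dNq := (dNq h p).
Local Notation dQp := (dQp h p).
Local Notation Wp := (Wp h p).
Local Notation Yh := (Yh h p).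
Local Notation Yn := (Yn h p).
Local Notation Yp := (Yp h p).
Variable G : 'rV[R]_(1 + N) -> 'M[R]_(1 + N).
Hypothesis GE : forall x, half_space x -> forall u w,
  (u *m G x *m w^T) 0 0 = gform h x u w.
Hypothesis Gcont : forall i j x, half_space x -> {for x, continuous (fun y => G y i j)}.
Hypothesis p0 : half_space p.

Lemma continuous_speed (c : R -> 'rV[R]_(1 + N)) (t : R) : C1_arc half_space c ->
  0 <= t <= 1 -> {for t, continuous (speed G c)}.
Proof.
move=> [dc cdc cU] t01; rewrite /speed.
apply: (@continuous_comp _ _ _
  (fun t => (derive1 c t *m G (c t) *m (derive1 c t)^T) 0 0) Num.sqrt);
  last exact: sqrt_continuous.
rewrite (_ : (fun t => _) = fun t =>
    \sum_j \sum_i derive1 c t 0 i * G (c t) i j * derive1 c t 0 j); last first.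
  apply/funext => s; rewrite mxE; apply: eq_bigr => j _.
  by rewrite !mxE mulr_suml.
have cc : {for t, continuous c}.
  by apply/differentiable_continuous/derivable1_diffP.
have ccoord i : {for t, continuous (fun s => derive1 c s 0 i)}.
  apply: (@continuous_comp _ _ _ (derive1 c) (fun v : 'rV[R]_(1 + N) => v 0 i)).
    exact: cdc.
  exact: coord_continuous.
apply: continuous_sum => j; apply: continuous_sum => i.
apply: cvgM; last exact: ccoord.
apply: cvgM; first exact: ccoord.
apply: (@continuous_comp _ _ _ c (fun y => G y i j)) => //.
exact/Gcont/cU.
Qed.

(* The smoothed radial function: at e = 0 it would be the distance to p, which
   is not differentiable at p. *)
Definition smooth_dist (e q : R) : R := ln (2 * q - 1 + 2 * Num.sqrt (q ^+ 2 - q + e)).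

(** For u = 2 q - 1 one has 4 (q^2 - q + e) = u^2 - 1 + 4 e, and ln(u + sqrt(u^2 + k)) has
    derivative 1 / sqrt(u^2 + k) in u. Putting e under the root keeps this exact. *)
Lemma is_derive_smooth_dist (e q : R) : 0 < e -> 1 <= q ->
  is_derive q (1 : R) (smooth_dist e) (Num.sqrt (q ^+ 2 - q + e))^-1.
Proof.
move=> e0 q1; have r0 : 0 < q ^+ 2 - q + e by nra.
have s0 : 0 < Num.sqrt (q ^+ 2 - q + e) by rewrite sqrtr_gt0.
have H1 : is_derive q (1 : R) (fun q : R => q ^+ 2 - q + e) (2 * q - 1).
  rewrite (_ : (fun q : R => q ^+ 2 - q + e) = (id * id) - id + cst e).
    by apply: is_derive_eq; rewrite /GRing.scale /= !mulr1; ring.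
  by apply/funext => y /=; rewrite expr2.
have H2 := is_derive_chain (g := fun q : R => q ^+ 2 - q + e)
  (is_derive1_sqrt r0) H1.
set sq := fun _ => _ in H2.
have H3 : is_derive q (1 : R) (fun q : R => 2 * q - 1 + 2 * sq q)
    (2 + (2 * q - 1) / Num.sqrt (q ^+ 2 - q + e)).
  rewrite (_ : (fun q : R => _) = (2 \*: id) - cst 1 + (2 \*: sq)).
    apply: is_derive_eq; rewrite /GRing.scale /=.
    by field; rewrite gt_eqF.
  by apply/funext.
have l0 : 0 < 2 * q - 1 + 2 * sq q by rewrite /sq; lra.
apply: (is_derive_eq (is_derive_chain (g := fun q : R => 2 * q - 1 + 2 * sq q)
  (is_derive1_ln l0) H3)).
by rewrite /sq; field; rewrite !gt_eqF.
Qed.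

(** By Cauchy-Schwarz dQ(c')^2 <= (Q^2 - Q) |c'|^2, so the derivative of the smoothed distance along
    c is at most sqrt((Q^2 - Q) / (Q^2 - Q + e)) |c'| <= |c'|. *)
Lemma smooth_dist_arc_length e c : 0 < e -> C1_arc half_space c ->
  `|smooth_dist e (Qp (c 1)) - smooth_dist e (Qp (c 0))| <= arc_length G c.
Proof.
move=> e0 Cc; have [dc cdc cU] := Cc.
pose D t := (Num.sqrt (Qp (c t) ^+ 2 - Qp (c t) + e))^-1 * dQp (c t) (derive1 c t).
apply: (@abs_increment_le_Rintegral _ (fun t => smooth_dist e (Qp (c t))) D).
- by move=> t t01; apply: continuous_speed.
- move=> t t01; have Ut := cU t t01.
  apply: (is_derive_chain (g := fun t => Qp (c t))).
    by apply: is_derive_smooth_dist => //; exact: Qp_ge1.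
  apply: is_derive_Qp => //; rewrite derive1E.
  by apply: derivableP.
- move=> t t01; have Ut := cU t t01; have Q1 := Qp_ge1 h p0 Ut.
  rewrite /D /speed GE// -gform_Yp//.
  set q := Qp (c t) in Q1 *; set u := derive1 c t.
  have r0 : 0 < q ^+ 2 - q + e by nra.
  have s0 : 0 < Num.sqrt (q ^+ 2 - q + e) by rewrite sqrtr_gt0.
  rewrite normrM ger0_norm ?invr_ge0 ?sqrtr_ge0// mulrC ler_pdivrMr//.
  rewrite -sqrtr_sqr -sqrtrM; last first.
    exact: gform_ge0.
  rewrite ler_sqrt; last first.
    by rewrite mulr_ge0 ?(ltW r0) ?gform_ge0.
  apply: le_trans (gform_CS h _ _ Ut) _; rewrite gform_YpYp// mulrC.
  apply: ler_wpM2l; last by rewrite -/q; lra.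
  exact: gform_ge0.
Qed.

Lemma smooth_dist_path_length e x y l : 0 < e -> path_length half_space G x y l ->
  `|smooth_dist e (Qp y) - smooth_dist e (Qp x)| <= l.
Proof.
move=> e0; elim => [z _|c z l' Cc _ IH]; first by rewrite subrr normr0.
rewrite -(subrKA (smooth_dist e (Qp (c 1)))) (le_trans (ler_normD _ _))// addrC.
by rewrite lerD// smooth_dist_arc_length.
Qed.

Lemma dist_lower x l : half_space x -> path_length half_space G x p l -> ln (exp_dist (Qp x)) <= l.
Proof.
move=> Ux H; apply/ler_addgt0Pr => d d0.
have Q1 := Qp_ge1 h p0 Ux.
(* With this e the smoothed distance at Q = 1 is ln(1 + d) <= d, so the error at the endpoint p is
   at most d. *)
pose e := (d / 2) ^+ 2; have e0 : 0 < e by rewrite exprn_gt0// divr_gt0.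
have := smooth_dist_path_length e0 H; rewrite Qp_self//.
have psi1 : smooth_dist e 1 <= d.
  rewrite /smooth_dist expr1n subrr add0r sqrtr_sqr ger0_norm ?divr_ge0 ?(ltW d0)//.
  have -> : 2 * 1 - 1 + 2 * (d / 2) = 1 + d by field.
  by apply: le_ln1Dx; lra.
have psiq : ln (exp_dist (Qp x)) <= smooth_dist e (Qp x).
  have s1 := exp_dist_ge1 Q1; rewrite /smooth_dist ler_ln ?posrE; last first.
  - have := sqrtr_ge0 (Qp x ^+ 2 - Qp x + e); lra.
  - lra.
  rewrite /exp_dist lerD2l ler_pM2l// ler_wsqrtr//; lra.
rewrite ler_norml => /andP[H1 _]; lra.
Qed.

End LowerBound.

(** * C^1 curves on the real line *)

Section C1.
Context {R : realType}.

Definition C1 (W : normedModType R) (f : R -> W) : Prop :=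
  (forall t, derivable f t 1) /\ continuous (derive1 f).

Lemma C1_continuous (W : normedModType R) (f : R -> W) : C1 f -> continuous f.
Proof.
by move=> [df _] t; apply/differentiable_continuous/derivable1_diffP.
Qed.

Lemma C1_cst (W : normedModType R) (w : W) : C1 (fun=> w).
Proof.
split=> [t|]; first exact: derivable_cst.
rewrite (_ : derive1 _ = cst 0); first by move=> t; exact: cst_continuous.
by apply/funext => t; rewrite derive1_cst.
Qed.

Lemma C1D (W : normedModType R) (f g : R -> W) : C1 f -> C1 g ->
  C1 (fun t => f t + g t).
Proof.
move=> [df cf] [dg cg]; split=> [t|]; first exact: derivableD.
rewrite (_ : derive1 _ = fun t => derive1 f t + derive1 g t).
  by move=> t; apply: cvgD; [exact: cf|exact: cg].
by apply/funext => t; rewrite !derive1E (deriveD (df t) (dg t)).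
Qed.

Lemma C1M (f g : R -> R) : C1 f -> C1 g -> C1 (fun t => f t * g t).
Proof.
move=> Cf Cg; have [df cf] := Cf; have [dg cg] := Cg.
split=> [t|]; first exact: derivableM.
rewrite (_ : derive1 _ = fun t => f t * derive1 g t + g t * derive1 f t).
  move=> t; exact: (cvgD (cvgM (C1_continuous Cf (x:=t)) (cg t))
    (cvgM (C1_continuous Cg (x:=t)) (cf t))).
by apply/funext => t; rewrite !derive1E (deriveM (df t) (dg t)).
Qed.

Lemma C1V (f : R -> R) : (forall t, f t != 0) -> C1 f -> C1 (fun t => (f t)^-1).
Proof.
move=> f0 Cf; have [df cf] := Cf; split=> [t|]; first exact: derivableV.
rewrite (_ : derive1 _ = fun t => (-1 * ((f t)^-1 * (f t)^-1)) * derive1 f t).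
  move=> t; have cV : {for t, continuous (fun s => (f s)^-1)}.
    by apply: cvgV; [exact: f0|exact: (C1_continuous Cf (x:=t))].
  apply: cvgM; last exact: cf.
  by apply: cvgM; [exact: cvg_cst|apply: cvgM; exact: cV].
apply/funext => t; rewrite !derive1E (deriveV (f0 t) (df t)) /GRing.scale /=.
by rewrite mulN1r -invfM -expr2.
Qed.

Lemma C1_scalev (W : normedModType R) (k : R -> R) (w : W) : C1 k ->
  C1 (fun t => k t *: w).
Proof.
move=> [dk ck].
have H t : is_derive t (1 : R) (fun t => k t *: w) (derive1 k t *: w).
  by apply: is_derive_scalev; rewrite derive1E; exact: derivableP.
split=> [t|]; first by case: (H t).
rewrite (_ : derive1 _ = fun t => derive1 k t *: w).
  move=> t; exact: (cvg_comp _ _ (ck t) (@scalel_continuous _ _ w (derive1 k t))).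
by apply/funext => t; have [_ <-] := H t; rewrite derive1E.
Qed.

Lemma C1_of_is_derive (f df : R -> R) :
  (forall t, is_derive t (1 : R) f (df t)) -> continuous df -> C1 f.
Proof.
move=> H cdf; split=> [t|]; first by case: (H t).
rewrite (_ : derive1 f = df)//.
by apply/funext => t; have [_ <-] := H t; rewrite derive1E.
Qed.

Lemma is_derive_div (f g : R -> R) (t df dg : R) : g t != 0 ->
  is_derive t (1 : R) f df -> is_derive t (1 : R) g dg ->
  is_derive t (1 : R) (fun t => f t / g t) ((df * g t - f t * dg) / g t ^+ 2).
Proof.
move=> g0 Hf Hg.
have Hi : is_derive t (1 : R) (fun t => (g t)^-1) (- (g t) ^- 2 * dg).
  have [ex2 val2] := Hg.
  by apply: DeriveDef; [exact: derivableV|rewrite deriveV// val2].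
apply: (is_derive_eq (is_deriveM Hf Hi)); rewrite /GRing.scale /=.
by field.
Qed.

End C1.

(** * Minimizing curves from the Cayley transform *)

Section Geodesic.
Context {R : realType} {N : nat} (h : htype R N) (p : 'rV[R]_(1 + N)).
Local Notation "''[' u , v ]" := (ip h u v).
Local Notation "''[' u ]" := (ip h u u).
Local Notation br := (br h).
Local Notation J := (Jmap h).
Local Notation pv := (pv h).
Local Notation pz := (1%:M - pv).
Local Notation b := (ht p).
Local Notation Vp := (Vp h p).
Local Notation Zp := (Zp h p).
Local Notation beta := (beta h p).
Local Notation Nq := (Nq h p).
Local Notation Qp := (Qp h p).
Local Notation dbeta := (dbeta h p).
Local Notation dNq := (dNq h p).
Local Notation dQp := (dQp h p).
Local Notation Wp := (Wp h p).
Local Notation Yh := (Yh h p).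
Local Notation Yn := (Yn h p).
Local Notation Yp := (Yp h p).
Hypothesis p0 : half_space p.

Section Curve.
Variables (s0 r : R) (y0 z0 : 'rV[R]_N).
Hypothesis y0v : y0 *m pv = y0.
Hypothesis z0z : z0 *m pv = 0.
Hypothesis r0 : 0 < r.
Hypothesis rE : r ^+ 2 = s0 ^+ 2 + '[z0] + '[y0] / b.

(** The Cayley transform sends (y, z, s) in the unit ball to the point with components 2 (1 - s +
    J_z) y, 2 z and 1 - |y|^2 - |z|^2 - s^2, all divided by (1 - s)^2 + |z|^2. Here it is evaluated
    at l times a fixed vector and translated by p; [y0] absorbs the factor b^(1/2) of this
    translation, hence |y0|^2 / b in [rE]. *)
Let chi (l : R) : R := (1 - s0 * l) ^+ 2 + l ^+ 2 * '[z0].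
Let K (l : R) : R := 1 - r ^+ 2 * l ^+ 2.
Let al (l : R) : R := 2 * l * (1 - s0 * l) / chi l.
Let ga (l : R) : R := 2 * l ^+ 2 / chi l.
Let de (l : R) : R := 2 * b * l / chi l.
Let aa (l : R) : R := b * K l / chi l.

Let Vl (u v : R) : 'rV[R]_N := u *: y0 + v *: J z0 y0.

(* The geodesics issued from p, as images of the radii of the unit ball under
   the Cayley transform; the parameter is tanh (t / 2) / r with t the arc
   length. *)
Definition cayley_ray (l : R) : 'rV[R]_(1 + N) :=
  mkpt (aa l) (nl p + Vl (al l) (ga l) + de l *: z0 +
             2^-1 *: br (nl p) (Vl (al l) (ga l))).

Let dchi (l : R) : R := - 2 * s0 * (1 - s0 * l) + 2 * l * '[z0].

Let is_derive_poly2 (k0 k1 k2 l : R) :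
  is_derive l (1 : R) (fun l : R => k0 + k1 * l + k2 * l ^+ 2) (k1 + 2 * k2 * l).
Proof.
rewrite (_ : (fun _ => _) = cst k0 + (k1 \*: id) + (k2 \*: (id * id))).
  by apply: is_derive_eq; rewrite /GRing.scale /=; ring.
by apply/funext => y /=; rewrite expr2.
Qed.

Let dchiP l : is_derive l (1 : R) chi (dchi l).
Proof.
rewrite (_ : chi = fun l => 1 + (- 2 * s0) * l + (s0 ^+ 2 + '[z0]) * l ^+ 2).
  by apply: (is_derive_eq (is_derive_poly2 _ _ _ _)); rewrite /dchi; ring.
by apply/funext => y; rewrite /chi; ring.
Qed.

Let dal l := ((2 - 4 * s0 * l) * chi l - 2 * l * (1 - s0 * l) * dchi l) / chi l ^+ 2.
Let dga l := (4 * l * chi l - 2 * l ^+ 2 * dchi l) / chi l ^+ 2.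
Let dde l := (2 * b * chi l - 2 * b * l * dchi l) / chi l ^+ 2.
Let daa l := (- 2 * b * r ^+ 2 * l * chi l - b * K l * dchi l) / chi l ^+ 2.

Let dalP l : chi l != 0 -> is_derive l (1 : R) al (dal l).
Proof.
move=> c0; apply: is_derive_div => //.
rewrite (_ : (fun _ => _) = fun l => 0 + 2 * l + (- 2 * s0) * l ^+ 2).
  by apply: (is_derive_eq (is_derive_poly2 _ _ _ _)); ring.
by apply/funext => y; ring.
Qed.

Let dgaP l : chi l != 0 -> is_derive l (1 : R) ga (dga l).
Proof.
move=> c0; apply: is_derive_div => //.
rewrite (_ : (fun _ => _) = fun l => 0 + 0 * l + 2 * l ^+ 2).
  by apply: (is_derive_eq (is_derive_poly2 _ _ _ _)); ring.
by apply/funext => y; ring.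
Qed.

Let ddeP l : chi l != 0 -> is_derive l (1 : R) de (dde l).
Proof.
move=> c0; apply: is_derive_div => //.
rewrite (_ : *%R (2 * b) = fun l => 0 + (2 * b) * l + 0 * l ^+ 2).
  by apply: (is_derive_eq (is_derive_poly2 _ _ _ _)); ring.
by apply/funext => y; ring.
Qed.

Let daaP l : chi l != 0 -> is_derive l (1 : R) aa (daa l).
Proof.
move=> c0; apply: is_derive_div => //.
rewrite (_ : (fun _ => _) = fun l => b + 0 * l + (- b * r ^+ 2) * l ^+ 2).
  by apply: (is_derive_eq (is_derive_poly2 _ _ _ _)); ring.
by apply/funext => y; rewrite /K; ring.
Qed.

Let dcay l : 'rV[R]_(1 + N) :=
  mkpt (daa l) (Vl (dal l) (dga l) + dde l *: z0 +
              2^-1 *: br (nl p) (Vl (dal l) (dga l))).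

Let Vl_pv u v : Vl u v *m pv = Vl u v.
Proof. by rewrite mulmxDl -!scalemxAl y0v Jm_pv. Qed.

(** Since [y0, J_z0 y0] = |y0|^2 z0, the span of y0, J_z0 y0, z0 and T is closed under the bracket:
    up to the translation by p the curve stays in the corresponding subgroup. *)
Let br_Vl u v u' v' : br (Vl u v) (Vl u' v') = ((u * v' - v * u') * '[y0]) *: z0.
Proof.
have E : br (J z0 y0) y0 = - ('[y0] *: z0) by rewrite brC br_Jm.
rewrite /Vl !brE E br_Jm//.
by apply/rowP => i; rewrite !mxE; ring.
Qed.

Let ip_Vl u v : '[Vl u v] = (u ^+ 2 + v ^+ 2 * '[z0]) * '[y0].
Proof. by rewrite /Vl !ipE [ip h y0 (J _ _)]ipC ip_Jm_id ip_JmJm//; ring. Qed.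

(** The speed 2 r / (1 - r^2 l^2) is that of a diameter of the Poincare ball, with primitive 2
    artanh(r l). *)
Lemma speed_cayley_ray l : 0 < chi l -> 0 < K l ->
  gform h (cayley_ray l) (dcay l) (dcay l) = 4 * r ^+ 2 / K l ^+ 2.
Proof.
move=> c0 K0; have b0 : 0 < b := p0.
have ztE : zframe h (cayley_ray l) (dcay l) =
    (dde l - 2^-1 * ((al l * dga l - ga l * dal l) * '[y0])) *: z0.
  rewrite /zframe /cayley_ray /dcay !nl_mkpt pzE 2!mulmxDl -!scalemxAl z0z br_z.
  rewrite Vl_pv !scaler0 !addr0 -[br _ (_ + _)]br_pvr 2!mulmxDl -!scalemxAl z0z br_z.
  rewrite Vl_pv !scaler0 !addr0 -[br (_ + _ + _ + _) _]br_pvl 3!mulmxDl -!scalemxAl z0z.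
  rewrite br_z Vl_pv !scaler0 !addr0 brDl br_pvl br_Vl.
  move: (Vl _ _) (br _ _) => v1 v2.
  by apply/rowP => i; rewrite !mxE; ring.
rewrite /gform ztE /dcay nl_mkpt 2!mulmxDl -!scalemxAl z0z br_z Vl_pv !scaler0 !addr0.
rewrite ip_Vl !ipE !ht_mkpt.
(* With w = s0 + i |z0|, [al] + i |z0| [ga] is 2 l / (1 - w l). Its derivative 2 / (1 - w l)^2 has
   squared modulus 4 / chi^2. *)
have E1 : dal l ^+ 2 + dga l ^+ 2 * '[z0] = 4 / chi l ^+ 2.
  move: (c0); rewrite /dal /dga /dchi /chi => c0'; field.
  by rewrite gt_eqF.
have E2 : dde l - 2^-1 * ((al l * dga l - ga l * dal l) * '[y0]) = 2 * b * K l / chi l ^+ 2.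
  move: (c0); rewrite /dde /dal /dga /al /ga /K rE /dchi /chi => c0'; field.
  by rewrite !gt_eqF.
rewrite E1 E2 /daa /aa.
have y2E : '[y0] = b * (r ^+ 2 - s0 ^+ 2 - '[z0]) by rewrite rE; field; rewrite gt_eqF.
rewrite y2E; move: (c0) (K0); rewrite /K /dchi /chi => c0' K0'; field.
by rewrite exprMn !gt_eqF.
Qed.

(** Inside the ball (s0 l)^2 <= (r l)^2 < 1, so 1 - s0 l > 0 and the denominator of the Cayley
    transform does not vanish. *)
Let chi_gt0 l : 0 < K l -> 0 < chi l.
Proof.
rewrite /K -exprMn => K0; have b0 : 0 < b := p0.
have y2 : 0 <= '[y0] / b by rewrite divr_ge0 ?ip_ge0// ltW.
have z2 := ip_ge0 h z0; have l2 := sqr_ge0 l.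
have E : (r * l) ^+ 2 = (s0 * l) ^+ 2 + l ^+ 2 * '[z0] + l ^+ 2 * ('[y0] / b).
  by rewrite exprMn rE; ring.
have H1 : 0 <= l ^+ 2 * '[z0] by rewrite mulr_ge0.
have H2 : 0 <= l ^+ 2 * ('[y0] / b) by rewrite mulr_ge0.
have H3 : s0 * l < 1 by nra.
by rewrite /chi ltr_pwDl// exprn_gt0// subr_gt0.
Qed.

Variables (D : R) (G : 'rV[R]_(1 + N) -> 'M[R]_(1 + N)).
Hypothesis D0 : 0 < D.
Hypothesis GE : forall x, half_space x -> forall u w,
  (u *m G x *m w^T) 0 0 = gform h x u w.

Let Et (t : R) : R := expR (D * (1 - t)).
(** This is tanh(D (1 - t) / 2) / r in terms of exponentials: it gives constant speed D, and time
    runs backwards so that the curve ends at p. *)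
Let lam (t : R) : R := (Et t - 1) / ((Et t + 1) * r).
Let dlam (t : R) : R := - (2 * D * Et t) / ((Et t + 1) ^+ 2 * r).

Let Et_gt0 t : 0 < Et t. Proof. exact: expR_gt0. Qed.

Let Et1r t : (Et t + 1) * r != 0.
Proof. by rewrite gt_eqF// mulr_gt0// addr_gt0. Qed.

Let K_lam t : K (lam t) = 4 * Et t / (Et t + 1) ^+ 2.
Proof.
have e0 := Et_gt0 t; rewrite /K /lam; field.
by rewrite !gt_eqF// addr_gt0.
Qed.

(** |r lam| < 1 holds for all real t and not just on [0, 1]; the curve is therefore C^1 on the whole
    line, as [C1_arc] demands. *)
Let K_lam_gt0 t : 0 < K (lam t).
Proof. by rewrite K_lam divr_gt0 ?mulr_gt0 ?exprn_gt0 ?addr_gt0. Qed.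

Let chi_lam t : chi (lam t) != 0.
Proof. by rewrite gt_eqF// chi_gt0. Qed.

Let EtP t : is_derive t (1 : R) Et (- D * Et t).
Proof.
have H : is_derive t (1 : R) (fun t : R => D * (1 - t)) (- D).
  rewrite (_ : (fun _ => _) = fun t : R => D + (- D) * t + 0 * t ^+ 2).
    by apply: (is_derive_eq (is_derive_poly2 _ _ _ _)); ring.
  by apply/funext => y; ring.
apply: (is_derive_eq (is_derive_chain (is_derive_expR _) H)).
by rewrite mulrC.
Qed.

Let lamP t : is_derive t (1 : R) lam (dlam t).
Proof.
have e0 := Et_gt0 t; have HE := EtP t.
have H1 : is_derive t (1 : R) (fun t => Et t - 1) (- D * Et t).
  rewrite (_ : (fun _ => _) = Et - cst 1); last by apply/funext.
  by apply: is_derive_eq; rewrite subr0.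
have H2 : is_derive t (1 : R) (fun t => (Et t + 1) * r) (- D * Et t * r).
  rewrite (_ : (fun _ => _) = r \*: (Et + cst 1)).
    by apply: is_derive_eq; rewrite addr0 /GRing.scale /= mulrC.
  by apply/funext => y /=; rewrite /GRing.scale /= mulrC.
apply: (is_derive_eq (is_derive_div (f := fun t => Et t - 1)
  (g := fun t => (Et t + 1) * r) (Et1r t) H1 H2)).
by rewrite /dlam; field; rewrite !gt_eqF// addr_gt0.
Qed.

Let C1_Et : C1 Et.
Proof.
apply: (C1_of_is_derive EtP) => t.
have cE : {for t, continuous Et}.
  by have [dE _] := EtP t; exact/differentiable_continuous/derivable1_diffP.
by apply: cvgM => //; exact: cvg_cst.
Qed.

Let C1_lam : C1 lam.
Proof.
exact: (C1M (C1D C1_Et (C1_cst _))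
  (C1V Et1r (C1M (C1D C1_Et (C1_cst _)) (C1_cst _)))).
Qed.

Let C1_sq (f : R -> R) : C1 f -> C1 (fun t => f t ^+ 2).
Proof. by move=> Cf; exact: (C1M Cf Cf). Qed.

Let C1_1s : C1 (fun t => 1 - s0 * lam t).
Proof.
have H := C1D (C1_cst (1 : R)) (C1M (C1_cst (- s0 : R)) C1_lam).
rewrite (_ : (fun _ => _) = fun t => 1 + (- s0) * lam t)//.
by apply/funext => t; rewrite mulNr.
Qed.

Let C1_K : C1 (fun t => K (lam t)).
Proof.
have H := C1D (C1_cst (1 : R)) (C1M (C1_cst (- r ^+ 2 : R)) (C1_sq C1_lam)).
rewrite (_ : (fun _ => _) = fun t => 1 + (- r ^+ 2) * lam t ^+ 2)//.
by apply/funext => t; rewrite /K mulNr.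
Qed.

Let C1_chiV : C1 (fun t => (chi (lam t))^-1).
Proof.
exact: (C1V chi_lam (C1D (C1_sq C1_1s) (C1M (C1_sq C1_lam) (C1_cst _)))).
Qed.

Let cur (t : R) := cayley_ray (lam t).

Let wy := y0 + 2^-1 *: br (nl p) y0.
Let wj := J z0 y0 + 2^-1 *: br (nl p) (J z0 y0).

(** Scalar functions times fixed vectors, so that derivative and C^1 regularity follow from those of
    four scalar coefficients. The brackets with [nl p] from the translation are absorbed into [wy]
    and [wj]. *)
Let curE : cur = fun t => aa (lam t) *: mkpt 1 0 + mkpt 0 (nl p) + al (lam t) *: mkpt 0 wy +
  ga (lam t) *: mkpt 0 wj + de (lam t) *: mkpt 0 z0.
Proof.
apply/funext => t; rewrite /cur /cayley_ray /wy /wj !mkptZ !mkptD; congr mkpt.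
  by ring.
rewrite /Vl brDr !brZr; move: (br (nl p) y0) (J z0 y0) => b1 j.
by apply/rowP => i; rewrite !mxE; ring.
Qed.

Let curP t : is_derive t (1 : R) cur (dlam t *: dcay (lam t)).
Proof.
have Hl := lamP t; have c0 := chi_lam t.
rewrite curE; apply: (@is_derive_eq _ _ _ _ _ _ _
  ((daa (lam t) * dlam t) *: mkpt 1 0 + 0 + (dal (lam t) * dlam t) *: mkpt 0 wy +
   (dga (lam t) * dlam t) *: mkpt 0 wj + (dde (lam t) * dlam t) *: mkpt 0 z0)).
  apply: is_deriveD; first apply: is_deriveD; first apply: is_deriveD;
    first apply: is_deriveD.
  - by apply: is_derive_scalev; exact: is_derive_chain (daaP c0) Hl.
  - by apply: is_derive_scalev; exact: is_derive_chain (dalP c0) Hl.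
  - by apply: is_derive_scalev; exact: is_derive_chain (dgaP c0) Hl.
  - by apply: is_derive_scalev; exact: is_derive_chain (ddeP c0) Hl.
rewrite addr0 /dcay /wy /wj !mkptZ !mkptD; congr mkpt; first by ring.
rewrite /Vl brDr !brZr; move: (br (nl p) y0) (J z0 y0) => b1 j.
by apply/rowP => i; rewrite !mxE; ring.
Qed.

Let C1_cur : C1 cur.
Proof.
have Ca : C1 (fun t => aa (lam t)) := C1M (C1M (C1_cst (b : R)) C1_K) C1_chiV.
have Cal : C1 (fun t => al (lam t)) :=
  C1M (C1M (C1M (C1_cst (2 : R)) C1_lam) C1_1s) C1_chiV.
have Cga : C1 (fun t => ga (lam t)) := C1M (C1M (C1_cst (2 : R)) (C1_sq C1_lam)) C1_chiV.
have Cde : C1 (fun t => de (lam t)) := C1M (C1M (C1_cst (2 * b : R)) C1_lam) C1_chiV.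
rewrite curE; exact: (C1D (C1D (C1D (C1D (C1_scalev _ Ca) (C1_cst _))
  (C1_scalev _ Cal)) (C1_scalev _ Cga)) (C1_scalev _ Cde)).
Qed.

Let cur_dom t : half_space (cur t).
Proof.
rewrite /half_space /= /cur /cayley_ray ht_mkpt divr_gt0 ?chi_gt0// mulr_gt0//.
Qed.

Lemma speed_cur t : speed G cur t = D.
Proof.
rewrite /speed derive1E; have [_ ->] := curP t.
rewrite GE// gform_scaleZ speed_cayley_ray ?chi_gt0// K_lam /dlam.
have e0 := Et_gt0 t.
rewrite [X in Num.sqrt X](_ : _ = D ^+ 2); last first.
  by field; rewrite !gt_eqF// addr_gt0.
by rewrite sqrtr_sqr gtr0_norm.
Qed.

Lemma cayley_path : path_length half_space G
  (cayley_ray ((expR D - 1) / ((expR D + 1) * r))) p D.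
Proof.
have -> : cayley_ray ((expR D - 1) / ((expR D + 1) * r)) = cur 0.
  by rewrite /cur /lam /Et subr0 mulr1.
have arcE : arc_length G cur = D.
  transitivity (\int[lebesgue_measure]_(t in `[0, 1]) D).
    by apply: eq_Rintegral => t _; exact: speed_cur.
  rewrite Rintegral_cst// /= lebesgue_measure_itv /= lte_fin ltr01 oppr0 adde0 /=.
  by rewrite mulr1.
rewrite -[D in path_length _ _ _ _ D]addr0 -[X in X + 0]arcE.
apply: path_length_cons.
  by have [dc cc] := C1_cur; split=> // t _; exact: cur_dom.
have -> : cur 1 = p.
  rewrite /cur /lam /Et subrr mulr0 expR0 subrr mul0r /cayley_ray.
  rewrite /aa /al /ga /de /K /chi /Vl !(mulr0, mul0r, expr0n, expr0, scale0r, addr0, subr0).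
  rewrite br0r scaler0 addr0 expr1n divr1 mulr1; exact: mkpt_eta.
exact: path_length_nil.
Qed.

End Curve.
End Geodesic.

(** * The distance to p, and the conclusion for radial functions *)

Section Harmonicity.
Context {R : realType} {N : nat} (h : htype R N) (p : 'rV[R]_(1 + N)).
Local Notation "''[' u , v ]" := (ip h u v).
Local Notation "''[' u ]" := (ip h u u).
Local Notation br := (br h).
Local Notation J := (Jmap h).
Local Notation pv := (pv h).
Local Notation pz := (1%:M - pv).
Local Notation b := (ht p).
Local Notation Vp := (Vp h p).
Local Notation Zp := (Zp h p).
Local Notation beta := (beta h p).
Local Notation Nq := (Nq h p).
Local Notation Qp := (Qp h p).
Local Notation dbeta := (dbeta h p).
Local Notation dNq := (dNq h p).
Local Notation dQp := (dQp h p).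
Local Notation Wp := (Wp h p).
Local Notation Yh := (Yh h p).
Local Notation Yn := (Yn h p).
Local Notation Yp := (Yp h p).
Variable G : 'rV[R]_(1 + N) -> 'M[R]_(1 + N).
Hypothesis GE : forall x, half_space x -> forall u w,
  (u *m G x *m w^T) 0 0 = gform h x u w.
Hypothesis Gcont : forall i j x, half_space x -> {for x, continuous (fun y => G y i j)}.
Hypothesis p0 : half_space p.

Section Target.
Variable x : 'rV[R]_(1 + N).
Hypothesis Ux : half_space x.
(** The inverse Cayley transform of p^-1 x, with the v-part rescaled as in the curve: these are the
    initial data of the ray that passes through x at l = 1. *)
Let s0 : R := 1 - 2 * b * beta x / Nq x.
Let y0 : 'rV[R]_N := (b / Nq x) *: (beta x *: Vp x - J (Zp x) (Vp x)).
Let z0 : 'rV[R]_N := (2 * b / Nq x) *: Zp x.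

Let b0 : 0 < b. Proof. exact: p0. Qed.
Let a0 : 0 < ht x. Proof. exact: Ux. Qed.

Let N0 : 0 < Nq x.
Proof.
have := Qp_ge1 h p0 Ux; rewrite /Qp ler_pdivlMr ?mulr_gt0// mul1r.
by apply: lt_le_trans; rewrite !mulr_gt0.
Qed.

Let V2 : '[Vp x] = 4 * (beta x - ht x - b).
Proof. by rewrite /beta; field. Qed.

Let ip_y0 : '[y0] = b ^+ 2 * '[Vp x] / Nq x.
Proof.
rewrite /y0; have J0 : '[J (Zp x) (Vp x), Vp x] = 0 by exact: ip_Jm_id.
have JJ : '[J (Zp x) (Vp x)] = '[Zp x] * '[Vp x].
  by rewrite ip_JmJm ?Zp_pv ?Vp_pv.
have n0 := N0; move: n0 J0 JJ; rewrite /Nq.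
move: (Zp x) (Vp x) (beta x) => Z V B n0.
move: (J Z V) => j J0 JJ; rewrite !ipE [ip h V j]ipC J0 JJ.
by field; rewrite gt_eqF.
Qed.

Let J_y0 : J z0 y0 = (2 * b ^+ 2 / Nq x ^+ 2) *:
  (beta x *: J (Zp x) (Vp x) + '[Zp x] *: Vp x).
Proof.
have JK := JmK (Zp_pv h p x) (Vp_pv h p x).
rewrite /z0 /y0; move: (Zp x) (Vp x) (beta x) (Nq x) N0 JK => Z V B n n0 JK.
rewrite !JmapE JK; move: (J Z V) => j.
by apply/rowP => i; rewrite !mxE; field; rewrite gt_eqF.
Qed.

(** For Q = cosh^2(d / 2) the right side is tanh^2(d / 2), the squared radius of x in the ball
    model. *)
Lemma target_sqnorm : s0 ^+ 2 + '[z0] + '[y0] / b = 1 - (Qp x)^-1.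
Proof.
rewrite ip_y0 /z0 ipZl ipZr V2 /s0 /Qp.
have Z2 : '[Zp x] = Nq x - beta x ^+ 2 by rewrite /Nq addrC addKr.
rewrite Z2; move: (Nq x) N0 => n n0.
by field; rewrite !gt_eqF.
Qed.

Lemma cayley_ray_target r : r ^+ 2 = s0 ^+ 2 + '[z0] + '[y0] / b ->
  cayley_ray h p s0 r y0 z0 1 = x.
Proof.
move=> rE; rewrite /cayley_ray.
(* Here 1 - s0 = 2 b beta / Nq and z0 = 2 b zeta / Nq, so one factor Nq = beta^2 + |zeta|^2
   cancels. *)
have chi1 : (1 - s0 * 1) ^+ 2 + 1 ^+ 2 * '[z0] = 4 * b ^+ 2 / Nq x.
  rewrite /z0 ipZl ipZr /s0.
  have Z2 : '[Zp x] = Nq x - beta x ^+ 2 by rewrite /Nq addrC addKr.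
  by rewrite Z2; move: (Nq x) N0 => n n0; field; rewrite gt_eqF.
rewrite chi1 rE target_sqnorm J_y0.
have -> : b * (1 - (1 - (Qp x)^-1) * 1 ^+ 2) / (4 * b ^+ 2 / Nq x) = ht x.
  by rewrite /Qp; field; rewrite !gt_eqF.
have -> : (2 * b * 1 / (4 * b ^+ 2 / Nq x)) *: z0 = Zp x.
  rewrite /z0 scalerA -[RHS]scale1r; congr (_ *: _).
  by field; rewrite !gt_eqF.
have -> : (2 * 1 * (1 - s0 * 1) / (4 * b ^+ 2 / Nq x)) *: y0 +
    (2 * 1 ^+ 2 / (4 * b ^+ 2 / Nq x)) *: ((2 * b ^+ 2 / Nq x ^+ 2) *:
      (beta x *: J (Zp x) (Vp x) + '[Zp x] *: Vp x)) = Vp x.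
  have Z2 : '[Zp x] = Nq x - beta x ^+ 2 by rewrite /Nq addrC addKr.
  rewrite Z2 /y0 /s0; move: (Vp x) (beta x) (Nq x) N0 (J _ _) => V B n n0 j.
  by apply/rowP => i; rewrite !mxE; field; rewrite !gt_eqF.
rewrite -[RHS]mkpt_eta; congr mkpt.
have brV : br (nl p) (Vp x) = br (nl p) (nl x).
  by rewrite /Vp br_pvr brDr brNr br_alt subr0.
rewrite brV /Zp; apply/eqP; rewrite -subr_eq0.
rewrite [X in X == 0](_ : _ = nl p - nl x + (Vp x + (nl x - nl p) *m pz)).
  by rewrite /Vp -mulmxDr [pv + _]addrC subrK mulmx1 -opprB addNr.
move: ((nl x - nl p) *m pz) (br _ _) (Vp x) => k1 k2 k3.
by apply/rowP => i; rewrite !mxE; ring.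
Qed.

End Target.

Lemma dist_upper x : half_space x -> path_length half_space G x p (ln (exp_dist (Qp x))).
Proof.
(* For x = p the radius r would be 0, by which [lam] divides; the empty path takes over. *)
move=> Ux; have [->|xp] := eqVneq x p.
  rewrite Qp_self// /exp_dist expr1n subrr sqrtr0 mulr0 addr0.
  have -> : 2 * 1 - 1 = 1 :> R by ring.
  by rewrite ln1; exact: path_length_nil.
have q1 := Qp_gt1 h p0 Ux xp.
have sK := exp_distK (ltW q1).
have s1 : 1 < exp_dist (Qp x).
  by have := sqrtr_ge0 (Qp x ^+ 2 - Qp x); rewrite /exp_dist; lra.
move: sK s1; move sE : (exp_dist (Qp x)) => s sK s1.
have s00 : 0 < s by lra.
(* With s = e^d this is tanh(d / 2), so that the parameter at time 0 is exactly 1, where the ray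
   meets x. *)
pose r := (s - 1) / (s + 1).
have r0 : 0 < r by rewrite divr_gt0; lra.
have rE : r ^+ 2 = 1 - (Qp x)^-1.
  rewrite -sK /r; field.
  by rewrite !gt_eqF//; lra.
have D0 : 0 < ln s by rewrite ln_gt0.
have rT := rE; rewrite -(target_sqnorm Ux) in rT.
have yv : (b / Nq x) *: (beta x *: Vp x - J (Zp x) (Vp x)) *m pv =
    (b / Nq x) *: (beta x *: Vp x - J (Zp x) (Vp x)).
  by rewrite -scalemxAl mulmxBl -scalemxAl Vp_pv Jm_pv.
have zz : (2 * b / Nq x) *: Zp x *m pv = 0 by rewrite -scalemxAl Zp_pv scaler0.
have := cayley_path p0 yv zz r0 rT D0 GE.
rewrite lnK ?posrE// (_ : (s - 1) / ((s + 1) * r) = 1).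
  by rewrite cayley_ray_target.
by rewrite /r; field; rewrite !gt_eqF//; lra.
Qed.

Lemma geodesic_distE x : half_space x -> geodesic_dist half_space G x p = ln (exp_dist (Qp x)).
Proof.
move=> Ux; apply/eqP; rewrite eq_le; apply/andP; split.
  apply: ge_inf; last exact: dist_upper.
  by exists (ln (exp_dist (Qp x))) => l; exact: dist_lower.
apply: lb_le_inf; first by exists (ln (exp_dist (Qp x))); exact: dist_upper.
by move=> l; exact: dist_lower.
Qed.

Lemma geodesic_dist_eq x y : half_space x -> half_space y ->
  geodesic_dist half_space G x p = geodesic_dist half_space G y p <-> Qp x = Qp y.
Proof.
move=> Ux Uy; rewrite !geodesic_distE//; split=> [|-> //].
have Qx := Qp_ge1 h p0 Ux; have Qy := Qp_ge1 h p0 Uy.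
have sx := exp_dist_ge1 Qx; have sy := exp_dist_ge1 Qy.
by move/ln_inj => E; apply: exp_dist_inj => //; apply: E; rewrite posrE; lra.
Qed.

Lemma laplace_preserves_radial f : Ck 2 half_space f -> radial half_space G p f ->
  radial half_space G p (laplace_beltrami G f).
Proof.
move=> Cf rf x y Ux Uy /(geodesic_dist_eq Ux Uy) Qxy.
have fQ u v : half_space u -> half_space v -> Qp u = Qp v -> f u = f v.
  by move=> Uu Uv /(geodesic_dist_eq Uu Uv); exact: rf.
have [F [F1 [F2 [fE dF dF1]]]] := radial_profile p0 Cf fQ.
have [C lapE] := laplace_radial GE p0 (fun y Uy _ => fE y Uy) dF dF1.
(* The formula for the Laplacian holds off p only. As Q = 1 forces the point p, x and y are either
   both p or both different from p. *)
have [xp|xp] := eqVneq x p.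
  have -> : y = p by apply: (@Qp1 _ _ h _ _ p0 Uy); rewrite -Qxy xp Qp_self.
  by rewrite xp.
have yp : y != p.
  by apply: contraNneq xp => yp; apply/eqP/(@Qp1 _ _ h _ _ p0 Ux); rewrite Qxy yp Qp_self.
by rewrite !lapE// Qxy.
Qed.

End Harmonicity.

(** * Passage to coordinates *)

Section Metric.
Context {R : realType} {N : nat} (h : htype R N).
Variable G : 'rV[R]_(1 + N) -> 'M[R]_(1 + N).
Hypothesis GE : forall x, half_space x -> forall u w,
  (u *m G x *m w^T) 0 0 = gform h x u w.

Lemma metric_entry x i j : half_space x -> G x i j = gform h x 'e_i 'e_j.
Proof. by move=> Ux; rewrite -GE// trmx_delta -rowE -colE !mxE. Qed.

(** Writing the frame as A - B / 2, with A constant and B linear in x, makes [gform] a polynomial in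
    1 / a and linear and quadratic expressions in x. *)
Lemma smooth_gform u w : smooth half_space (fun x => gform h x u w).
Proof.
move=> k; have oU := @open_half_space R N.
have Ci : Ck k half_space (fun x : 'rV[R]_(1 + N) => (ht x)^-1).
  apply: Ck_inv => //; first by move=> x; rewrite /half_space /= => /lt0r_neq0.
  by apply: Ck_linear => // c x y; rewrite htP.
pose A v : 'rV[R]_N := nl v *m (1%:M - pv h).
pose B v x : 'rV[R]_N := br h (nl x) (nl v).
have Bl v c x y : B v (c *: x + y) = c *: B v x + B v y.
  by rewrite /B nlP brDl brZl.
have C1 a v : Ck k half_space (fun x => ip h a (B v x)).
  by apply: Ck_linear => // c x y; rewrite Bl ipDr ipZr.
have C2 : Ck k half_space (fun x => ip h (B u x) (B w x)).
  apply: (@Ck_quadratic _ _ _ oU k (fun x y => ip h (B u x) (B w y))) => // v c x y.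
    by rewrite Bl ipDr ipZr.
  by rewrite Bl ipDl ipZl.
have Cc (c : R) := Ck_cst oU k c.
have CDD := CkD oU (CkD oU (CkD oU (Cc (ip h (A u) (A w)))
  (CkM oU (Cc (- 2^-1)) (C1 (A u) w))) (CkM oU (Cc (- 2^-1)) (C1 (A w) u)))
  (CkM oU (Cc (4^-1)) C2).
apply: Ck_eq (CkD oU (CkM oU Ci (Cc (ip h (nl u *m pv h) (nl w *m pv h))))
  (CkM oU (CkM oU Ci Ci) (CkD oU CDD (Cc (ht u * ht w))))) => // x Ux.
rewrite /gform /zframe -/(A u) -/(A w) -/(B u x) -/(B w x).
move: (A u) (A w) (B u x) (B w x) => a a' c c'.
by rewrite !ipE [ip h c a']ipC; field; rewrite lt0r_neq0.
Qed.

Lemma riemannian_htype : riemannian_space half_space G.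
Proof.
split.
- exact: open_half_space.
- exact: connected_half_space.
- move=> i j k; apply: Ck_eq (smooth_gform 'e_i 'e_j k); first exact: open_half_space.
  by move=> x Ux; rewrite metric_entry.
- move=> x Ux; apply/matrixP => i j.
  by rewrite mxE !metric_entry// gformC.
- by move=> x u Ux u0; rewrite GE//; exact: gform_gt0.
Qed.

Lemma harmonic_htype : harmonic_space half_space G.
Proof.
split; first exact: riemannian_htype.
move=> p f Up; have [_ _ sm _ _] := riemannian_htype.
apply: (laplace_preserves_radial GE) => // i j x Ux.
by have [c _] := sm i j 0%N; exact: c.
Qed.

End Metric.

(** * From an abstract H-type algebra to coordinates *)

Section Coordinates.
Context {R : realType} {n : vectType R}.
Variables (lieb : {bilinear n -> n -> n}) (inner : {dot n for idfun}).
Hypothesis Hn : h_type_algebra lieb inner.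

Local Notation N := (\dim {:n}).
Local Notation rv := (rVof (vbasis {:n})).
Local Notation ve := (vecof (vbasis {:n})).
Local Notation z := (lie_center lieb).
Local Notation v := (v_space lieb inner).
Local Notation vp := (vpart lieb inner).
Local Notation zp := (zpart lieb inner).

Let rvK : cancel rv ve. Proof. exact/rVofK/vbasisP. Qed.
Let veK : cancel ve rv. Proof. exact/vecofK/vbasisP. Qed.

Let rvD a b : rv (a + b) = rv a + rv b. Proof. exact: linearD. Qed.
Let rvZ (c : R) a : rv (c *: a) = c *: rv a. Proof. exact: linearZ. Qed.
Let veD a b : ve (a + b) = ve a + ve b. Proof. exact: linearD. Qed.
Let veZ (c : R) a : ve (c *: a) = c *: ve a. Proof. exact: linearZ. Qed.

Let brxx x : lieb x x = 0. Proof. by case: Hn => -[]. Qed.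

Let br_anti x y : lieb x y = - lieb y x.
Proof.
apply/eqP; rewrite -addr_eq0; have := brxx (x + y).
by rewrite linearDl !linearDr !brxx add0r addr0 => ->.
Qed.

Let ip_sym x y : inner x y = inner y x.
Proof. by rewrite hermC expr0 mul1r. Qed.

Let ip_posdef x : x != 0 -> 0 < inner x x.
Proof. exact: neq0_dnorm_gt0. Qed.

Let br_center x y : lieb x y \in z.
Proof.
case: Hn => _ [n2 _] _; apply/lie_centerP => w.
by rewrite br_anti n2 oppr0.
Qed.

Let ip_v_z x y : x \in v -> y \in z -> inner x y = 0.
Proof. by move=> /mem_orthovP H /H. Qed.

Let capvz : (v :&: z = 0)%VS.
Proof.
apply/eqP; rewrite -subv0; apply/subvP => x; rewrite memv_cap memv0 => /andP[xv xz].
by apply: contraT => /ip_posdef; rewrite (ip_v_z xv xz) ltxx.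
Qed.

Let capzv : (z :&: v = 0)%VS. Proof. by rewrite capvC capvz. Qed.

(** Dimension count: v is cut out by orthogonality to a basis of the center, imposed one vector at a
    time, and each condition lowers the dimension by at most one. *)
Let addvz : (v + z = fullv)%VS.
Proof.
apply/eqP; rewrite eqEdim subvf /= dimv_disjoint_sum ?capvz//.
have H (s : seq n) : exists2 V : {vspace n}, (N <= \dim V + size s)%N &
    forall x, x \in V -> {in s, forall u, inner x u = 0}.
  elim: s => [|u s [V dV Vs]]; first by exists fullv; rewrite ?addn0.
  exists (V :&: orthov inner <[u]>)%VS.
    rewrite /= addnS -addSn (leq_trans dV)// leq_add2r.
    by have := leq_dim_orthov1 inner u V; case: (\dim V).
  move=> x; rewrite memv_cap mem_orthov1 => /andP[xV /eqP xu] w.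
  by rewrite inE => /predU1P[-> //|]; exact: Vs.
have [V dV Vz] := H (vbasis z); rewrite size_tuple in dV.
apply: leq_trans dV _; rewrite leq_add2r; apply: dimvS; apply/subvP => x xV.
apply/mem_orthovP => w wz; rewrite (coord_vbasis wz) linear_sumr big1// => i _.
by rewrite linearZr /= Vz ?mulr0// mem_nth// size_tuple.
Qed.

Let vzE x : vp x + zp x = x.
Proof. by rewrite /vpart /zpart daddv_pi_add ?capvz// addvz memvf. Qed.

Let vpv x : vp x \in v. Proof. exact: memv_pi. Qed.
Let zpz x : zp x \in z. Proof. exact: memv_pi. Qed.
Let vp_id x : x \in v -> vp x = x. Proof. exact/daddv_pi_id/capvz. Qed.
Let zp_id x : x \in z -> zp x = x. Proof. exact/daddv_pi_id/capzv. Qed.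

Let vp_z x : x \in z -> vp x = 0.
Proof. by move=> xz; apply: (addIr (zp x)); rewrite vzE add0r zp_id. Qed.

Let vp_linear : linear vp. Proof. by move=> c x y; rewrite /vpart linearP. Qed.

Let br_vpl x y : lieb (vp x) y = lieb x y.
Proof. by rewrite -[x in RHS]vzE linearDl (lie_centerP _ _ (zpz x)) addr0. Qed.

Let ip_vp x y : inner (vp x) y = inner x (vp y).
Proof.
rewrite -[y in LHS]vzE -[x in RHS]vzE linearDr linearDl /=.
by rewrite (ip_v_z (vpv x) (zpz y)) [inner (zp x) _]ip_sym (ip_v_z (vpv y) (zpz x)).
Qed.

Let cip (u w : 'rV[R]_N) : R := inner (ve u) (ve w).
Let cbr (u w : 'rV[R]_N) : 'rV[R]_N := rv (lieb (ve u) (ve w)).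
Let cpv : 'M[R]_N := lin1_mx (fun u => rv (vp (ve u))).
(** The hypothesis gives a separate map for each central Z, determined on v only. Solving the
    defining identity with the inverse Gram matrix gives instead one map on the whole space, linear
    in both arguments. *)
Let cJ (c x : 'rV[R]_N) : 'rV[R]_N :=
  (\row_j cip (cbr x 'e_j) c) *m invmx (gram cip).

Let cip_scalarl w : scalar (cip^~ w).
Proof. by move=> a x y; rewrite /cip linearP linearPl. Qed.
Let cipC u w : cip u w = cip w u. Proof. exact: ip_sym. Qed.
Let cip_scalarr w : scalar (cip w).
Proof. by move=> a x y; rewrite ![cip w _]cipC cip_scalarl. Qed.
Let cip_gt0 u : u != 0 -> 0 < cip u u.
Proof. by move=> u0; apply: ip_posdef; rewrite vecof_eq0//; exact: vbasisP. Qed.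

Let cbr_linearl w : linear (cbr^~ w).
Proof. by move=> a x y; rewrite /cbr !linearP linearPl linearP. Qed.
Let cbr_linearr w : linear (cbr w).
Proof. by move=> a x y; rewrite /cbr !linearP. Qed.
Let cbr_alt u : cbr u u = 0. Proof. by rewrite /cbr brxx linear0. Qed.

Let cpvE u : u *m cpv = rv (vp (ve u)).
Proof. by apply: lin1_mxP => a x y; rewrite linearP vp_linear linearP. Qed.

Let cpv_idem : cpv *m cpv = cpv.
Proof.
by apply/row_matrixP => i; rewrite !rowE mulmxA !cpvE rvK vp_id.
Qed.

Let cip_pv u w : cip (u *m cpv) w = cip u (w *m cpv).
Proof. by rewrite /cip !cpvE !rvK ip_vp. Qed.

Let cbr_pvl u w : cbr (u *m cpv) w = cbr u w.
Proof. by rewrite /cbr cpvE rvK br_vpl. Qed.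

Let cbr_z u w : cbr u w *m cpv = 0.
Proof. by rewrite cpvE /cbr rvK vp_z ?linear0. Qed.

Let gram_unit : gram cip \in unitmx.
Proof. by apply: posdef_unitmx => u u0; rewrite gramE//; exact: cip_gt0. Qed.

Let cip_J c x y : cip (cJ c x) y = cip (cbr x y) c.
Proof.
rewrite -[LHS]gramE// /cJ mulmxKV// mxE.
rewrite [y in RHS](row_sum_delta y).
pose l u := cip (cbr x u) c.
have ll : scalar l by move=> a s t; rewrite /l cbr_linearr cip_scalarl.
pose L : {scalar 'rV[R]_N} := HB.pack l (GRing.isLinear.Build R _ _ _ l ll).
rewrite -[RHS]/(L _) linear_sum; apply: eq_bigr => j _.
by rewrite linearZ /= !mxE mulrC.
Qed.

Let cip_inj u u' : (forall w, cip u w = cip u' w) -> u = u'.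
Proof.
move=> H; apply/eqP; rewrite -subr_eq0; apply: contraT => /cip_gt0.
have -> : cip (u - u') (u - u') = 0.
  by rewrite {1}addrC -scaleN1r cip_scalarl H mulN1r addNr.
by rewrite ltxx.
Qed.

Let cJ_linearl x : linear (cJ^~ x).
Proof.
by move=> a s t; apply: cip_inj => w; rewrite cip_scalarl !cip_J cip_scalarr.
Qed.
Let cJ_linearr c : linear (cJ c).
Proof.
move=> a s t; apply: cip_inj => w.
by rewrite cip_scalarl !cip_J cbr_linearl cip_scalarl.
Qed.

(** On v, [cJ] agrees with the map supplied by the hypothesis, both being determined by the same
    inner products; that map preserves v, so the formula for its square carries over. *)
Let cJK c x : c *m cpv = 0 -> x *m cpv = x -> cJ c (cJ c x) = - cip c c *: x.
Proof.
rewrite !cpvE => c0 xv.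
have cz : ve c \in z.
  have : vp (ve c) = 0 by apply: (can_inj rvK); rewrite c0 linear0.
  by rewrite -{2}[ve c]vzE => ->; rewrite add0r.
have xV : ve x \in v by rewrite -xv rvK.
have [_ _ /(_ _ cz)[J JJ JK]] := Hn.
have E y : ve y \in v -> cJ c y = rv (J (ve y)).
  move=> yv; have [Jv Jip] := JJ _ yv; apply: cip_inj => w.
  rewrite cip_J /cip /cbr !rvK -[ve w in RHS]vzE linearDr /= (ip_v_z Jv (zpz _)) addr0.
  by rewrite Jip// br_anti [in RHS]br_anti br_vpl.
have [Jv _] := JJ _ xV.
by rewrite [cJ c x]E// E rvK// JK// linearZ /= veK.
Qed.

Definition htype_coords : htype R N := Htype cip_scalarl cipC cip_gt0 cbr_linearl
  cbr_linearr cbr_alt cJ_linearl cJ_linearr cpv_idem cip_pv cbr_pvl cbr_z cip_J cJK.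

Let br_vpr x y : lieb x (vp y) = lieb x y.
Proof. by rewrite br_anti br_vpl -br_anti. Qed.

Local Notation H := htype_coords.

Let ve_zt x u : ve (zframe H x u) =
  zp (ve (nl u)) - 2^-1 *: lieb (ve (nl x)) (ve (nl u)).
Proof.
rewrite /zframe linearB linearZ /= /cbr rvK mulmxBr mulmx1 linearB /= cpvE rvK.
by congr (_ - _); rewrite -{1}[ve (nl u)]vzE addrC addKr.
Qed.

(** In the chart a left translation by a fixed element is affine, so its differential is its linear
    part, the map [l] below. For q = x^-1 the v-part of q is - a^(-1/2) X, which yields the bracket
    term of [zframe]. *)
Lemma maurer_cartanE x u : 0 < ht x -> maurer_cartan lieb inner x u =
  (ve ((Num.sqrt (ht x))^-1 *: (nl u *m pv H) + (ht x)^-1 *: zframe H x u),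
   (ht x)^-1 * ht u).
Proof.
move=> x0; rewrite /maurer_cartan.
have spE : s_point x = (ve (nl x), ht x) by [].
set q := s_inv lieb inner (s_point x).
have q2 : q.2 = (ht x)^-1 by [].
have q2s : Num.sqrt q.2 = (Num.sqrt (ht x))^-1 by rewrite q2 sqrtrV// ltW.
have q1 : vp q.1 = - (Num.sqrt (ht x))^-1 *: vp (ve (nl x)).
  rewrite /q /s_inv spE /= -scaleNr [_ + _ *: zp _]addrC vp_linear (vp_z (zpz _)).
  by rewrite scaler0 add0r /vpart linearZ /= -/(vp _) -/(vp _) (vp_id (vpv _)).
pose l (w : 'rV[R]_(1 + N)) : 'rV[R]_(1 + N) := mkpt (q.2 * ht w)
  (rv (Num.sqrt q.2 *: vp (ve (nl w)) + (q.2 *: zp (ve (nl w)) +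
    (2^-1 * Num.sqrt q.2) *: lieb (vp q.1) (vp (ve (nl w)))))).
have ll : linear l.
  move=> c w w'; rewrite /l mkptZ mkptD htP nlP; congr mkpt; first by ring.
  rewrite veD veZ vp_linear /zpart (linearP (daddv_pi _ _)) linearPr /=.
  rewrite -/(zp _) -/(zp _).
  move: (vp (ve (nl w))) (vp (ve (nl w'))) (zp (ve (nl w))) (zp (ve (nl w'))) => a a' d d'.
  rewrite !(rvD, rvZ); apply/rowP => i; rewrite !mxE; ring.
have fE : left_translation lieb inner q =
    cst (mkpt 0 (rv (vp q.1 + zp q.1))) + l :> (_ -> _).
  apply/funext => w; rewrite fctE /l mkptD add0r -linearD.
  rewrite /left_translation /s_chart /s_mul /= -/(mkpt _ _); congr (mkpt _ (rv _)).
  by rewrite -!addrA; congr (_ + _); rewrite addrCA; congr (_ + _).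
have -> : 'd (left_translation lieb inner q) x u = l u.
  rewrite -deriveE; last first.
    by rewrite fE; apply: differentiableD => //; exact: differentiable_rVlinear.
  rewrite fE; have Hl := is_derive_rVlinear ll (is_derive_id x u).
  by have [_ ->] := is_deriveD (is_derive_cst (mkpt 0 (rv (vp q.1 + zp q.1))) x u) Hl;
    rewrite add0r.
rewrite /l /s_point -/(nl _) -/(ht _) nl_mkpt ht_mkpt rvK q2s q2; congr pair.
rewrite veD !veZ ve_zt cpvE rvK; congr (_ + _).
rewrite q1 scalerBr; congr (_ + _); rewrite linearZl_LR /= br_vpl br_vpr.
rewrite !scalerA -scaleNr; congr (_ *: _).
have {3}-> : ht x = Num.sqrt (ht x) ^+ 2 by rewrite sqr_sqrtr// ltW.
by field; rewrite gt_eqF// sqrtr_gt0.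
Qed.

Lemma s_metricE x : half_space x -> forall u w,
  (u *m s_metric lieb inner x *m w^T) 0 0 = gform H x u w.
Proof.
move=> Ux; have x0 : 0 < ht x := Ux.
have -> : s_metric lieb inner x = gram (gform H x).
  apply/matrixP => i j; rewrite !mxE !maurer_cartanE// /s_dot /=.
  rewrite -/(cip _ _) -[cip]/(ip H).
  rewrite /gform.
  have ztv w' : zframe H x w' *m pv H = 0 by rewrite /zframe mulmxBl pz_pv -scalemxAl br_z scaler0 subr0.
  have vv (y' : 'rV[R]_N) : y' *m pv H *m pv H = y' *m pv H by rewrite -mulmxA pv_idem.
  move: (ztv 'e_i) (ztv 'e_j) (vv (nl 'e_i)) (vv (nl 'e_j)).
  move: (zframe H x 'e_i) (zframe H x 'e_j) (nl 'e_i *m pv H) (nl 'e_j *m pv H) => z1 z2 v1 v2.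
  move=> z10 z20 v10 v20; rewrite !ipE (ip_vz v10 z20) [ip H z1 v2]ipC (ip_vz v20 z10).
  have -> : (ht x)^-1 = (Num.sqrt (ht x))^-1 ^+ 2.
    by rewrite exprVn sqr_sqrtr ?ltW.
  by ring.
apply: gramE => v'; [exact: gform_scalarr|exact: gform_scalarl].
Qed.

End Coordinates.

Theorem mainTheorem1 (R : realType) (n : vectType R)
    (br : {bilinear n -> n -> n}) (ip : {dot n for idfun}) :
  h_type_algebra br ip ->
  harmonic_space (s_domain (n := n)) (s_metric br ip).
Proof. by move=> Hn; exact: (harmonic_htype (s_metricE Hn)). Qed.
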